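(* Let $\Phi\in\mathrm C^0(\Omega)$ and $\Lambda\in\mathbb R$, and define $\widetilde\Phi:\mathfrak C_\Omega\to\mathbb R$ by $\widetilde\Phi([x,r])=r^2\Phi(x)$. Then the functional $\mathcal F_\Phi:\mathcal M(\Omega)\to\mathbb R$, $\mathcal F_\Phi(\mu)=\int_\Omega\Phi(x)\,\mathrm d\mu(x)$, is $\Lambda$-convex along all geodesic curves of $(\mathcal M(\Omega),\mathsf{HK})$ of the form $\mu(s)=\mathfrak P\big(Z(s;\cdot,\cdot)_\#\gamma\big)$, $s\in[0,1]$ (with $\gamma$ an optimal plan for optimal lifts of $\mu(0),\mu(1)$), if and only if $\widetilde\Phi$ is geodesically $\Lambda$-convex on $(\mathfrak C_\Omega,\mathsf d_{\mathfrak C})$.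
   Context: $\Omega\subset\mathbb R^d$ is convex and compact; $\mathcal M(\Omega)$ is the set of finite nonnegative Borel measures on $\Omega$. The cone over $\Omega$ is $\mathfrak C_\Omega:=(\Omega\times[0,\infty[)/(\Omega\times\{0\})$, with points $[x,r]$ and tip $\mathfrak o=[x,0]$, and metric $\mathsf d_{\mathfrak C}([x_0,r_0],[x_1,r_1])^2=r_0^2+r_1^2-2r_0r_1\cos_\pi(|x_0-x_1|)$, $\cos_\pi(L)=\cos(\min\{L,\pi\})$. $\mathcal M_2(\mathfrak C_\Omega)$ is the set of finite nonnegative Borel measures with $\int r^2\mathrm d\lambda<\infty$. $\mathsf W_{\mathfrak C}(\lambda_0,\lambda_1)^2=\inf\iint\mathsf d_{\mathfrak C}^2\,\mathrm d\gamma$ over nonnegative measures $\gamma$ on $\mathfrak C_\Omega\times\mathfrak C_\Omega$ with marginals $\lambda_0,\lambda_1$ ($=\infty$ if the masses differ); minimizers are optimal plans. The projection $\mathfrak P:\mathcal M_2(\mathfrak C_\Omega)\to\mathcal M(\Omega)$ is given by $\int_\Omega\phi\,\mathrm d\mathfrak P\lambda=\int r^2\phi(x)\,\mathrm d\lambda([x,r])$, $\phi\in\mathrm C^0(\Omega)$; $\lambda$ is a lift of $\mu$ if $\mathfrak P\lambda=\mu$. The Hellinger–Kantorovich distance is $\mathsf{HK}(\mu_0,\mu_1)=\min\{\mathsf W_{\mathfrak C}(\lambda_0,\lambda_1)\mid\mathfrak P\lambda_j=\mu_j\}$; minimizing pairs are optimal lifts. $Z(\cdot;z_0,z_1):[0,1]\to\mathfrak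 C_\Omega$ is the unique constant-speed minimal geodesic in $(\mathfrak C_\Omega,\mathsf d_{\mathfrak C})$ from $z_0$ to $z_1$. In a metric space $(Y,\mathsf D)$, a function $F:Y\to\mathbb R$ is $\Lambda$-convex along a constant-speed minimal geodesic $y:[0,1]\to Y$ if $F(y(s))\le(1-s)F(y(0))+sF(y(1))-\Lambda\frac{s(1-s)}2\mathsf D(y(0),y(1))^2$ for all $s\in[0,1]$; it is geodesically $\Lambda$-convex if this holds along all such geodesics. *)

(* Defs.v *)
From HB Require Import structures.
From mathcomp Require Import all_boot all_order all_algebra.
From mathcomp Require Import generic_quotient.
From mathcomp Require Import all_classical all_reals all_analysis.

Set Implicit Arguments.
Unset Strict Implicit.
Unset Printing Implicit Defensive.

Import Order.TTheory GRing.Theory Num.Theory.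
Import numFieldNormedType.Exports.

Local Open Scope classical_set_scope.
Local Open Scope ring_scope.
Local Open Scope quotient_scope.

Section distances.
Context (R : realType) (Y : Type).
Implicit Types (D : Y -> Y -> R) (y : R -> Y) (F : Y -> R).

Definition dist_open D : set (set Y) :=
  [set U | forall x, U x ->
    exists2 e : R, 0 < e & forall x', D x x' < e -> U x'].

(* Curves [0,1] -> Y are represented by functions on R, of which only the
   restriction to [0,1] is ever used. *)
Definition is_geodesic D y := forall s t : R, 0 <= s <= 1 -> 0 <= t <= 1 ->
  D (y s) (y t) = `|s - t| * D (y 0) (y 1).

Definition convex_along D F (Lambda : R) y := forall s : R, 0 <= s <= 1 ->
  F (y s) <= (1 - s) * F (y 0) + s * F (y 1)
             - Lambda * (s * (1 - s) / 2) * D (y 0) (y 1) ^+ 2.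

Definition geodesically_convex D F (Lambda : R) :=
  forall y, is_geodesic D y -> convex_along D F Lambda y.

End distances.

(* The norm of the library on 'rV[R]_d is the sup norm. *)
Definition enorm (R : realType) (d : nat) (x : 'rV[R]_d) : R :=
  Num.sqrt (\sum_(i < d) x ord0 i ^+ 2).

Definition cos_pi (R : realType) (L : R) : R := cos (Num.min L pi).

(* Omega as a type, with the subspace topology. The proof of nonemptiness is a
   parameter because measurable types are pointed in the library. *)
Definition dom (R : realType) (d : nat) (Omega : set 'rV[R]_d)
  (ne : Omega !=set0) : Type := set_type Omega.

HB.instance Definition _ (R : realType) (d : nat) (Omega : set 'rV[R]_d)
  (ne : Omega !=set0) := Topological.copy (dom ne) (set_type Omega).

HB.instance Definition _ (R : realType) (d : nat) (Omega : set 'rV[R]_d)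
    (ne : Omega !=set0) :=
  isPointed.Build (dom ne)
    (exist (fun x => x \in Omega) _ (mem_set (projT2 (cid ne)))).

Section cone.
Context (R : realType) (d : nat) (Omega : set 'rV[R]_d) (ne : Omega !=set0).

Definition domB := g_sigma_algebraType (@open (dom ne)).

Definition cone_rel : rel (dom ne * {nonneg R}) :=
  fun p q => (p.2 == q.2) && ((p.2 == 0%:nng) || (p.1 == q.1)).

Lemma cone_rel_refl : reflexive cone_rel.
Proof. by move=> p; rewrite /cone_rel !eqxx orbT. Qed.

Lemma cone_rel_sym : symmetric cone_rel.
Proof.
move=> p q; rewrite /cone_rel (eq_sym q.2) (eq_sym q.1).
by case: (eqVneq p.2 q.2) => [->|].
Qed.

Lemma cone_rel_trans : transitive cone_rel.
Proof.
move=> q p r; rewrite /cone_rel => /andP[/eqP -> pq] /andP[/eqP <- qr].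
rewrite eqxx /=; case: (eqVneq q.2 0%:nng) pq qr => //= _.
by move=> /eqP -> /eqP ->.
Qed.

Canonical cone_equiv :=
  EquivRel cone_rel cone_rel_refl cone_rel_sym cone_rel_trans.

Definition cone : Type := {eq_quot cone_rel}.
HB.instance Definition _ := Choice.on cone.

Definition cone_pt (x : dom ne) (r : {nonneg R}) : cone :=
  \pi_({eq_quot cone_rel}) (x, r).

HB.instance Definition _ := isPointed.Build cone (cone_pt point 0%:nng).

(* Coordinates of a representative; at the tip the base point is arbitrary, and
   it is used only in expressions where it is multiplied by the radius. *)
Definition cone_x (z : cone) : dom ne := (repr (z : {eq_quot cone_rel})).1.
Definition cone_r (z : cone) : R := (repr (z : {eq_quot cone_rel})).2%:num.

Definition dcone (z0 z1 : cone) : R :=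
  Num.sqrt (cone_r z0 ^+ 2 + cone_r z1 ^+ 2
    - 2 * cone_r z0 * cone_r z1
      * cos_pi (enorm (\val (cone_x z0) - \val (cone_x z1)))).

Definition cone_fun (Phi : dom ne -> R) (z : cone) : R :=
  cone_r z ^+ 2 * Phi (cone_x z).

Lemma cone_ptP x r :
  cone_r (cone_pt x r) = r%:num /\ (r%:num != 0 -> cone_x (cone_pt x r) = x).
Proof.
rewrite /cone_r /cone_x /cone_pt.
case: (piP {eq_quot cone_rel} (x, r)) => -[x' r'] /=.
move=> /eqmodP /= /andP[/= /eqP <-] h; split=> // r0.
by move: h => /orP[/eqP h|/eqP //]; rewrite h eqxx in r0.
Qed.

Lemma dcone_pt x0 r0 x1 r1 : dcone (cone_pt x0 r0) (cone_pt x1 r1) =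
  Num.sqrt (r0%:num ^+ 2 + r1%:num ^+ 2
    - 2 * r0%:num * r1%:num * cos_pi (enorm (\val x0 - \val x1))).
Proof.
rewrite /dcone; have [-> h0] := cone_ptP x0 r0; have [-> h1] := cone_ptP x1 r1.
have [->|/h0 ->] := eqVneq r0%:num 0; first by rewrite mulr0 !mul0r.
by have [->|/h1 ->] := eqVneq r1%:num 0; first by rewrite mulr0 !mul0r.
Qed.

Lemma cone_fun_pt Phi x r :
  cone_fun Phi (cone_pt x r) = r%:num ^+ 2 * Phi x.
Proof.
rewrite /cone_fun; have [-> h] := cone_ptP x r.
by have [->|/h ->] := eqVneq r%:num 0; first by rewrite expr2 !mul0r.
Qed.

(* Z(s; z0, z1) is [cone_geod z0 z1 s]. When Omega is convex, a constant-speed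
   minimal geodesic from z0 to z1 exists and is unique on [0,1], so neither the
   default value nor the choice made by [xget] matters there. *)
Definition cone_geod (z0 z1 : cone) : R -> cone :=
  xget (cst z0) [set y | [/\ is_geodesic dcone y, y 0 = z0 & y 1 = z1]].

Definition coneB := g_sigma_algebraType (dist_open dcone).

Definition second_moment_finite (la : {finite_measure set coneB -> \bar R}) :=
  (\int[la]_z (cone_r z ^+ 2)%:E < +oo)%E.

(* [is_lift la mu]: la belongs to M_2 of the cone and P(la) = mu. *)
Definition is_lift (la : {finite_measure set coneB -> \bar R})
    (mu : {finite_measure set domB -> \bar R}) :=
  second_moment_finite la /\
  forall phi : dom ne -> R, continuous phi ->
    \int[mu]_x phi x = \int[la]_z (cone_r z ^+ 2 * phi (cone_x z)).

(* By separability, the product of the Borel sigma-algebras on coneB * coneB is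
   the Borel sigma-algebra of the product. *)
Definition is_plan (la0 la1 : {finite_measure set coneB -> \bar R})
    (ga : {measure set (coneB * coneB)%type -> \bar R}) :=
  forall A : set coneB, measurable A ->
    ga (A `*` setT) = la0 A /\ ga (setT `*` A) = la1 A.

Definition plan_cost (ga : {measure set (coneB * coneB)%type -> \bar R}) :
  \bar R := (\int[ga]_p (dcone p.1 p.2 ^+ 2)%:E)%E.

(* The infimum is +oo when there is no plan, i.e. when the masses differ. *)
Definition Wcone (la0 la1 : {finite_measure set coneB -> \bar R}) : \bar R :=
  sqrte (ereal_inf [set plan_cost ga | ga in is_plan la0 la1]).

Definition optimal_plan (la0 la1 : {finite_measure set coneB -> \bar R})
    (ga : {measure set (coneB * coneB)%type -> \bar R}) :=
  is_plan la0 la1 ga /\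
  plan_cost ga = ereal_inf [set plan_cost ga' | ga' in is_plan la0 la1].

Definition HKe (mu0 mu1 : {finite_measure set domB -> \bar R}) : \bar R :=
  ereal_inf [set w | exists la0 la1,
    [/\ is_lift la0 mu0, is_lift la1 mu1 & w = Wcone la0 la1]].

(* The infimum in HKe is attained; [optimal_lifts] are the minimizing pairs.
   HKe is always finite: mass can be added at the tip of the cone to give two
   lifts the same total mass. *)
Definition HK (mu0 mu1 : {finite_measure set domB -> \bar R}) : R :=
  fine (HKe mu0 mu1).

Definition optimal_lifts (mu0 mu1 : {finite_measure set domB -> \bar R})
    (la0 la1 : {finite_measure set coneB -> \bar R}) :=
  [/\ is_lift la0 mu0, is_lift la1 mu1 & Wcone la0 la1 = HKe mu0 mu1].

Definition plan_curve (mu : R -> {finite_measure set domB -> \bar R}) :=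
  exists (la0 la1 : {finite_measure set coneB -> \bar R})
         (ga : {measure set (coneB * coneB)%type -> \bar R}),
    [/\ optimal_lifts (mu 0) (mu 1) la0 la1, optimal_plan la0 la1 ga &
      forall s : R, 0 <= s <= 1 ->
        exists la : {finite_measure set coneB -> \bar R},
          (forall A : set coneB, measurable A ->
            la A = pushforward ga
              (fun p : coneB * coneB => cone_geod p.1 p.2 s : coneB) A) /\
          is_lift la (mu s)].

Definition potential_energy (Phi : dom ne -> R)
  (mu : {finite_measure set domB -> \bar R}) : R := \int[mu]_x Phi x.

End cone.

(* Main.v *)
(* If the cone function is Lambda-convex along cone geodesics, its convexity
   inequality along Z(.; z0, z1) is integrated against the optimal plan. This
   needs Z(s; ., .) to be measurable, which is read off an explicit formula:
   Z(s) has the polar coordinates of (1-s) r0 + s r1 exp(i t), where t is the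
   capped angle between the end points.

   Conversely, when r0 r1 cos t >= 0 (the angle is at most pi/2, or an end point
   is the tip), Dirac masses at z0 and z1 are optimal lifts, so cone
   geodesics project to HK geodesics and the inequality is inherited. A geodesic
   with a larger angle is not covered directly. If t < pi it is the union of two
   acute geodesics with overlapping parameter intervals, and convexity glues. If
   t = pi it passes through the tip, where the cone function vanishes, and the two
   halves fit together because Phi >= Lambda / 2, which is the inequality on the
   segments issuing from the tip. *)

Require Import Defs.
From HB Require Import structures.
From mathcomp Require Import all_boot all_order all_algebra.
From mathcomp Require Import all_classical all_reals all_analysis.
From mathcomp Require Import measurable_realfun ring lra.
Set Implicit Arguments.
Unset Strict Implicit.
Unset Printing Implicit Defensive.

Import Order.TTheory GRing.Theory Num.Theory.
Import numFieldNormedType.Exports.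
Local Open Scope classical_set_scope.
Local Open Scope ring_scope.

(** * Planar triangles and polar coordinates *)

Section trigonometry.
Context (R : realType).
Implicit Types (A B C a b c t r : R).

(** Two cone points behave like planar vectors of lengths r0, r1 enclosing the angle t in [0, pi];
    [dcone] is the third side of that triangle. One obstacle is that [cone_geod] is a choice, so
    nothing can be computed from it until geodesics are known to be unique, also through the tip and
    at t = pi, where the capped metric no longer sees Euclidean distances. Uniqueness comes from
    writing a vanishing quantity as a sum of nonnegative terms. Another obstacle is that the base
    point is arbitrary at the tip. Measurability into the cone is therefore tested on r and r x,
    which stay continuous there. The threshold pi/2 arises because a lift may carry extra mass at
    the tip. Moving both masses through the tip costs r0^2 + r1^2, which is below the squared
    distance as soon as r0 r1 cos t < 0, so Dirac lifts then fail to be optimal. Otherwise a dual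
    certificate with two weights bounds every plan between every pair of lifts. An obtuse geodesic
    is cut at the parameters where it is orthogonal to one of its ends. *)

Lemma cos_le_cosD a b t : 0 <= a -> 0 <= b -> a + b <= pi -> 0 <= t ->
  t <= a + b -> cos a * cos b - sin a * sin b <= cos t.
Proof.
move=> a0 b0 ab t0 tab; rewrite -cosD leNgt; apply/negP.
by rewrite ltr_cos ?ltNge ?tab // in_itv /= ?t0 ?(le_trans tab) ?addr_ge0.
Qed.

(** For a + b <= pi the left side of the inequality is |r - A exp(-i a) - B exp(i b)|^2 + 2 A B (cos
    t - cos (a + b)), a sum of nonnegative terms. Each of them must vanish: [K] and [S] are the real
    part and, up to sign, the imaginary part of A exp(-i a) + B exp(i b). *)
Lemma cos_gap_le0 A B a b t r :
  0 < A -> 0 < B -> 0 <= a <= pi -> 0 <= b <= pi -> 0 <= t <= pi ->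
  t <= a + b -> 0 < r ->
  r ^+ 2 - 2 * r * (A * cos a + B * cos b)
    + (A ^+ 2 + B ^+ 2 + 2 * A * B * cos t) <= 0 ->
  [/\ r ^+ 2 = A ^+ 2 + B ^+ 2 + 2 * A * B * cos t,
      r * cos a = A + B * cos t & a + b = t].
Proof.
move=> A0 B0 /andP[a0 api] /andP[b0 bpi] /andP[t0 tpi] tab r0 H.
have ca := cos2Dsin2 a; have cb := cos2Dsin2 b.
(* If a + b > pi, then cos b < - cos a and cos t >= -1 put the left side strictly above |r - (A - B)
   exp(i a)|^2, which is absurd. *)
have [abpi|abpi] := leP (a + b) pi; last first.
  exfalso; have ct := cos_geN1 t.
  have: cos b < - cos a.
    have -> : - cos a = cos (pi - a) by rewrite addrC cosDpi cosN.
    rewrite ltr_cos ?in_itv /= ?b0 ?bpi ?subr_ge0 ?api //; first lra.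
    by rewrite gerBl a0.
  move=> cba; have sa := sqr_ge0 (sin a).
  have h1 : B * r * cos b < B * r * - cos a by rewrite ltr_pM2l// mulr_gt0.
  have h2 : - (A * B) <= A * B * cos t.
    by rewrite -mulrN1 ler_pM2l ?mulr_gt0.
  have h3 : 0 <= (r - (A - B) * cos a) ^+ 2 + (A - B) ^+ 2 * sin a ^+ 2.
    by apply: addr_ge0; [|apply: mulr_ge0]; exact: sqr_ge0.
  have : (r - (A - B) * cos a) ^+ 2 + (A - B) ^+ 2 * sin a ^+ 2 =
     r ^+ 2 - 2 * r * (A - B) * cos a + (A - B) ^+ 2.
    rewrite sin2cos2; ring.
  lra.
have ct := @cos_le_cosD a b t a0 b0 abpi t0 tab.
have AB0 : 0 < A * B by rewrite mulr_gt0.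
pose K := A * cos a + B * cos b; pose S := A * sin a - B * sin b.
pose g := cos t - (cos a * cos b - sin a * sin b).
have e : (r - K) ^+ 2 + S ^+ 2 + 2 * (A * B) * g <= 0.
  apply: le_trans H; rewrite le_eqVlt; apply/orP; left; apply/eqP.
  rewrite /K /S /g.
  have -> : (A * sin a - B * sin b) ^+ 2 = A ^+ 2 * sin a ^+ 2 +
    B ^+ 2 * sin b ^+ 2 - 2 * A * B * (sin a * sin b) by ring.
  rewrite !sin2cos2; ring.
have g0 : 0 <= g by rewrite subr_ge0.
have h1 := sqr_ge0 (r - K); have h2 := sqr_ge0 S.
have h3 : 0 <= 2 * (A * B) * g by apply: mulr_ge0 => //; apply: mulr_ge0 => //; exact: ltW.
have /eqP : (r - K) ^+ 2 = 0 by lra.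
rewrite sqrf_eq0 subr_eq0 => /eqP rK.
have /eqP : S ^+ 2 = 0 by lra.
rewrite sqrf_eq0 subr_eq0 => /eqP S0.
have /eqP : 2 * (A * B) * g = 0 by lra.
rewrite mulf_eq0 gt_eqF ?mulr_gt0//= subr_eq0 => /eqP gt.
split.
- rewrite gt rK /K.
  have -> : A ^+ 2 = A ^+ 2 * cos a ^+ 2 + (A * sin a) ^+ 2
    by rewrite exprMn sin2cos2; ring.
  have -> : B ^+ 2 = B ^+ 2 * cos b ^+ 2 + (B * sin b) ^+ 2
    by rewrite exprMn sin2cos2; ring.
  have -> : (A * cos a + B * cos b) ^+ 2 = A ^+ 2 * cos a ^+ 2 +
    B ^+ 2 * cos b ^+ 2 + 2 * A * B * (cos a * cos b) by ring.
  have -> : 2 * A * B * (cos a * cos b - sin a * sin b) =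
    2 * A * B * (cos a * cos b) - (A * sin a) * (B * sin b) *+ 2 by ring.
  rewrite S0; ring.
- rewrite gt rK /K mulrBr.
  have -> : B * (sin a * sin b) = (B * sin b) * sin a by ring.
  rewrite -S0.
  have -> : A * sin a * sin a = A * sin a ^+ 2 by ring.
  rewrite sin2cos2; ring.
- apply/esym/cos_inj; rewrite ?in_itv /= ?t0 ?addr_ge0//.
  by rewrite gt cosD.
Qed.

Lemma one_sided_gap C c r : 0 <= C -> 0 < r -> 0 <= c <= pi ->
  r ^+ 2 - 2 * r * (C * cos c) + C ^+ 2 = 0 -> r = C /\ c = 0.
Proof.
move=> C0 r0 c0pi h; have c1 := cos_le1 c.
have p : 0 <= 2 * r * C * (1 - cos c).
  by apply: mulr_ge0; [apply: mulr_ge0 => //; lra|lra].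
have q := sqr_ge0 (r - C).
have /eqP : (r - C) ^+ 2 = 0 by lra.
rewrite sqrf_eq0 subr_eq0 => /eqP rC; split=> //.
have /eqP : 2 * r * C * (1 - cos c) = 0 by lra.
rewrite -rC !mulf_eq0 pnatr_eq0 (gt_eqF r0) /= subr_eq0 => /eqP c1'.
by apply: cos_inj; rewrite ?in_itv/= ?lexx ?pi_ge0// cos0.
Qed.

(** Here [al] is the argument of A + B exp(i t), a nonnegative combination of two directions, so it
    lies between 0 and t. *)
Lemma polar_sum A B t r : 0 <= A -> 0 <= B -> 0 <= t <= pi ->
  r = Num.sqrt (A ^+ 2 + B ^+ 2 + 2 * A * B * cos t) ->
  let al := Num.min t (acos ((A + B * cos t) / r)) in
  [/\ r * cos al = A + B * cos t, r * sin al = B * sin t & 0 <= al <= t].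
Proof.
move=> A0 B0 /andP[t0 tpi] rE al.
have ct := cos2Dsin2 t.
have rE2 : A ^+ 2 + B ^+ 2 + 2 * A * B * cos t =
    (A + B * cos t) ^+ 2 + (B * sin t) ^+ 2.
  by rewrite [(B * _) ^+ 2]exprMn sin2cos2; ring.
have r2 : r ^+ 2 = (A + B * cos t) ^+ 2 + (B * sin t) ^+ 2.
  by rewrite rE -rE2 sqr_sqrtr// rE2 addr_ge0 ?sqr_ge0.
have [r0|r0] := eqVneq r 0.
  move: r2; rewrite r0 expr0n /= => /esym/eqP.
  rewrite paddr_eq0 ?sqr_ge0// !sqrf_eq0 => /andP[/eqP h1 /eqP h2].
  rewrite !mul0r h1 h2; split=> //; rewrite /al r0 invr0 mulr0 acos0.
  by rewrite le_min t0 ge_min lexx /= divr_ge0 ?pi_ge0.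
have rgt0 : 0 < r by rewrite lt_neqAle eq_sym r0 rE sqrtr_ge0.
set u := (A + B * cos t) / r in al *.
have ru : r * u = A + B * cos t by rewrite mulrC divfK.
have u1 : -1 <= u <= 1.
  rewrite -ler_norml -(@ler_pXn2r _ 2) ?nnegrE// expr1n real_normK ?num_real//.
  rewrite -(ler_pM2l (exprn_gt0 2 rgt0)) mulr1 -exprMn ru r2.
  by rewrite lerDl sqr_ge0.
have ac : cos (acos u) = u by rewrite acosK ?in_itv.
(* This makes the minimum in [al] equal to the arccosine. When cos t and A + B cos t are both
   negative, the comparison is made between squares. *)
have cu : cos t <= u.
  rewrite -(ler_pM2l rgt0) ru.
  have st : 0 <= sin t by rewrite sin_ge0_pi// t0.
  have [c0|c0] := leP 0 (cos t).
    have rAB : r <= A + B.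
      rewrite -(@ler_pXn2r _ 2) ?nnegrE ?addr_ge0 ?(ltW rgt0)// r2.
      rewrite -rE2; have := cos_le1 t => c1.
      have : A * B * cos t <= A * B * 1 by rewrite ler_wpM2l ?mulr_ge0.
      lra.
    have := cos_le1 t => c1.
    have : r * cos t <= (A + B) * cos t by rewrite ler_wpM2r.
    have : A * cos t <= A * 1 by rewrite ler_wpM2l.
    lra.
  have [h|h] := leP 0 (A + B * cos t).
    by apply: le_trans h; rewrite mulr_ge0_le0 ?(ltW c0) ?(ltW rgt0).
  rewrite -lerN2 -(@ler_pXn2r _ 2) ?nnegrE ?oppr_ge0 ?(ltW h)//; last first.
    by rewrite mulr_ge0_le0 ?(ltW c0) ?(ltW rgt0).
  rewrite !sqrrN exprMn r2 -subr_ge0.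
  have -> : ((A + B * cos t) ^+ 2 + (B * sin t) ^+ 2) * cos t ^+ 2 -
    (A + B * cos t) ^+ 2 =
    (A * sin t ^+ 2) * (- (A + B * cos t) - B * cos t)
     - (A + B * cos t) ^+ 2 * (1 - (cos t ^+ 2 + sin t ^+ 2)).
    ring.
  rewrite ct subrr mulr0 subr0; apply: mulr_ge0.
    by apply: mulr_ge0 => //; exact: sqr_ge0.
  have := mulr_ge0_le0 B0 (ltW c0); lra.
have au : acos u <= t.
  rewrite leNgt; apply/negP; rewrite -ltr_cos ?in_itv /= ?t0 ?tpi ?acos_ge0 ?acos_lepi//.
  by rewrite ac ltNge cu.
have alE : al = acos u by rewrite /al; apply/min_idPr.
rewrite alE acos_ge0// au ac ru; split=> //.
apply/eqP; rewrite -(@eqrXn2 _ 2) ?mulr_ge0 ?sin_ge0_pi ?t0 ?acos_ge0 ?acos_lepi ?(ltW rgt0)//.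
rewrite exprMn sin2cos2 ac mulrBr mulr1 -exprMn ru r2; apply/eqP; ring.
Qed.
End trigonometry.

(** * The Euclidean norm and the equality case of its triangle inequality *)

Section euclidean_norm.
Context (R : realType) (d : nat).
Implicit Types (u v x y : 'rV[R]_d) (k : R).

Definition dotr u v : R := \sum_(i < d) u ord0 i * v ord0 i.

Lemma dotrC u v : dotr u v = dotr v u.
Proof. by apply: eq_bigr => i _; rewrite mulrC. Qed.

Lemma dotrDl u v x : dotr (u + v) x = dotr u x + dotr v x.
Proof. by rewrite -big_split; apply: eq_bigr => i _; rewrite mxE mulrDl. Qed.

Lemma dotrZl k u v : dotr (k *: u) v = k * dotr u v.
Proof. by rewrite mulr_sumr; apply: eq_bigr => i _; rewrite mxE mulrA. Qed.

Lemma enorm_ge0 u : 0 <= enorm u.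
Proof. exact: sqrtr_ge0. Qed.

Lemma sqr_enorm u : enorm u ^+ 2 = dotr u u.
Proof.
rewrite sqr_sqrtr; first by apply: eq_bigr => i _; rewrite expr2.
by apply: sumr_ge0 => i _; rewrite sqr_ge0.
Qed.

Lemma enormZ k u : enorm (k *: u) = `|k| * enorm u.
Proof.
apply/eqP; rewrite -(@eqrXn2 _ 2) ?mulr_ge0 ?enorm_ge0//.
by rewrite exprMn real_normK ?num_real// !sqr_enorm dotrZl dotrC dotrZl mulrA expr2.
Qed.

Lemma enormN u : enorm (- u) = enorm u.
Proof. by rewrite -scaleN1r enormZ normrN1 mul1r. Qed.

Lemma enorm_distC u v : enorm (u - v) = enorm (v - u).
Proof. by rewrite -enormN opprB. Qed.

Lemma le_coord_enorm u i : `|u ord0 i| <= enorm u.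
Proof.
rewrite -(@ler_pXn2r _ 2) ?nnegrE ?enorm_ge0// real_normK ?num_real// sqr_enorm.
rewrite /dotr (bigD1 i)//= -expr2 lerDl.
by apply: sumr_ge0 => j _; rewrite -expr2 sqr_ge0.
Qed.

Lemma enorm0_eq0 u : enorm u = 0 -> u = 0.
Proof.
move=> u0; apply/rowP => i; rewrite mxE; apply/eqP; rewrite -normr_le0 -u0.
exact: le_coord_enorm.
Qed.

Lemma enorm0 : enorm (0 : 'rV[R]_d) = 0.
Proof. by rewrite -(scale0r 0) enormZ normr0 mul0r. Qed.

(** One identity serves twice: its sign yields the Cauchy-Schwarz inequality, and its vanishing
    yields collinearity when the triangle inequality is an equality. *)
Lemma sqr_enorm_comb u v : enorm (enorm v *: u - enorm u *: v) ^+ 2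
  = 2 * enorm u * enorm v * (enorm u * enorm v - dotr u v).
Proof.
rewrite -scaleNr sqr_enorm !(dotrDl, dotrZl) !(dotrC _ (_ + _)) !(dotrDl, dotrZl).
rewrite (dotrC v u) -!sqr_enorm; ring.
Qed.

Lemma dotr_le u v : dotr u v <= enorm u * enorm v.
Proof.
have [u0|u0] := eqVneq (enorm u) 0.
  by rewrite (enorm0_eq0 u0) -(scale0r 0) dotrZl enormZ normr0 !mul0r.
have [v0|v0] := eqVneq (enorm v) 0.
  by rewrite (enorm0_eq0 v0) dotrC -(scale0r 0) dotrZl enormZ normr0 !mul0r mulr0.
have p : 0 < 2 * enorm u * enorm v.
  by rewrite !mulr_gt0// lt_neqAle eq_sym ?u0 ?v0 enorm_ge0.
by rewrite -subr_ge0 -(pmulr_rge0 _ p) -sqr_enorm_comb sqr_ge0.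
Qed.

Lemma sqr_enormD u v :
  enorm (u + v) ^+ 2 = enorm u ^+ 2 + enorm v ^+ 2 + 2 * dotr u v.
Proof.
rewrite !sqr_enorm !dotrDl !(dotrC _ (_ + _)) !dotrDl (dotrC v u); ring.
Qed.

Lemma ler_enormD u v : enorm (u + v) <= enorm u + enorm v.
Proof.
rewrite -(@ler_pXn2r _ 2) ?nnegrE ?addr_ge0 ?enorm_ge0// sqr_enormD sqrrD.
have := dotr_le u v; lra.
Qed.

Lemma enormD_eq u v : enorm (u + v) = enorm u + enorm v ->
  enorm v *: u = enorm u *: v.
Proof.
move=> /(congr1 (fun k : R => k ^+ 2)); rewrite sqr_enormD sqrrD => h.
apply/eqP; rewrite -subr_eq0; apply/eqP/enorm0_eq0/eqP.
rewrite -sqrf_eq0 sqr_enorm_comb; apply/eqP.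
have -> : enorm u * enorm v - dotr u v = 0 by lra.
by rewrite mulr0.
Qed.

Lemma enorm_segment x0 x1 x : enorm (x - x0) + enorm (x1 - x) = enorm (x1 - x0) ->
  enorm (x1 - x0) *: (x - x0) = enorm (x - x0) *: (x1 - x0).
Proof.
move=> h; have e : x1 - x0 = (x - x0) + (x1 - x) by rewrite [RHS]addrC addrA subrK.
rewrite -{1}h scalerDl [in RHS]e [in RHS]scalerDr; congr (_ + _).
by apply: enormD_eq; rewrite -e.
Qed.

End euclidean_norm.

(** * Angles on the cone and uniqueness of intermediate points *)

Section cone_geometry.
Context (R : realType) (d : nat) (Omega : set 'rV[R]_d) (ne : Omega !=set0).
Implicit Types (z w : cone ne) (s u : R).

(** At the tip the value depends on the arbitrary base point; the triangle inequality holds for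
    these values as well. *)
Definition cone_angle z w : R :=
  Num.min (enorm (\val (cone_x z) - \val (cone_x w))) pi.

Lemma cone_angle_itv z w : 0 <= cone_angle z w <= pi.
Proof. by rewrite le_min enorm_ge0 pi_ge0 ge_min lexx orbT. Qed.

Lemma cone_angle_triangle z0 z z1 :
  cone_angle z0 z1 <= cone_angle z0 z + cone_angle z z1.
Proof.
rewrite /cone_angle.
set a := enorm (_ - \val (cone_x z)); set b := enorm (\val (cone_x z) - _).
have tri : enorm (\val (cone_x z0) - \val (cone_x z1)) <= a + b.
  apply: le_trans (ler_enormD _ _); rewrite le_eqVlt; apply/orP; left.
  by rewrite addrA subrK.
have [a0 b0] : 0 <= a /\ 0 <= b by rewrite !enorm_ge0.
have p := pi_ge0 R.
by rewrite ge_min; apply/orP; case: (leP a pi); case: (leP b pi); lra.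
Qed.

Lemma cone_angle_eq0 z w : cone_angle z w = 0 -> cone_x z = cone_x w.
Proof.
rewrite /cone_angle; case: leP => [_ /enorm0_eq0/eqP|_ p0].
  by rewrite subr_eq0 => /eqP/val_inj.
by have := pi_gt0 R; rewrite p0 ltxx.
Qed.

Lemma cone_r_ge0 z : 0 <= cone_r z.
Proof. by rewrite /cone_r. Qed.

Lemma cone_eqP z w : cone_r z = cone_r w ->
  (cone_r z != 0 -> cone_x z = cone_x w) -> z = w.
Proof.
move=> rE xE; rewrite -[z]reprK -[w]reprK; apply/eqmodP.
rewrite /= /cone_rel; apply/andP; split; first exact/eqP/val_inj.
have [r0|r0] := eqVneq (cone_r z) 0; first by apply/orP; left; apply/eqP/val_inj.
by apply/orP; right; apply/eqP; exact: xE.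
Qed.

Lemma dcone_ge0 z w : 0 <= dcone z w.
Proof. exact: sqrtr_ge0. Qed.

Lemma sqr_dcone z w : dcone z w ^+ 2 = cone_r z ^+ 2 + cone_r w ^+ 2
  - 2 * cone_r z * cone_r w * cos (cone_angle z w).
Proof.
rewrite sqr_sqrtr// -/(cone_angle z w) /cos_pi.
have c1 := cos_le1 (cone_angle z w).
have h : cone_r z * cone_r w * cos (cone_angle z w) <= cone_r z * cone_r w * 1.
  by rewrite ler_wpM2l// mulr_ge0 ?cone_r_ge0.
have := sqr_ge0 (cone_r z - cone_r w); rewrite -/(cone_angle z w); lra.
Qed.

Section between.
Context (s : R) (z0 z1 : cone ne).
Hypothesis s01 : 0 <= s <= 1.
Local Notation A := ((1 - s) * cone_r z0).
Local Notation B := (s * cone_r z1).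
Local Notation t := (cone_angle z0 z1).

Definition between z :=
  dcone z0 z = s * dcone z0 z1 /\ dcone z z1 = (1 - s) * dcone z0 z1.

(** Stewart's identity in the planar triangle with sides r0, r1 and [dcone z0 z1]: the left side is
    |(1 - s) r0 + s r1 exp(i t)|^2. *)
Lemma sqr_speed : A ^+ 2 + B ^+ 2 + 2 * A * B * cos t =
  (1 - s) * cone_r z0 ^+ 2 + s * cone_r z1 ^+ 2
    - s * (1 - s) * dcone z0 z1 ^+ 2.
Proof. rewrite sqr_dcone; ring. Qed.

(** Weighting the two squared distance equations by 1 - s and s gives [cone_r z ^+ 2] the
    coefficient 1 and produces the expression of [cos_gap_le0], here with value 0. *)
Lemma between_eq z : between z ->
  cone_r z ^+ 2 - 2 * cone_r z *
    (A * cos (cone_angle z0 z) + B * cos (cone_angle z z1))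
  + (A ^+ 2 + B ^+ 2 + 2 * A * B * cos t) = 0.
Proof.
move=> [h0 h1]; rewrite sqr_speed.
transitivity ((1 - s) * (dcone z0 z ^+ 2 - (s * dcone z0 z1) ^+ 2)
  + s * (dcone z z1 ^+ 2 - ((1 - s) * dcone z0 z1) ^+ 2)).
  rewrite (sqr_dcone z0 z) (sqr_dcone z z1); ring.
by rewrite h0 h1 !subrr !mulr0 addr0.
Qed.

Let A_ge0 : 0 <= A.
Proof. by move: s01 => /andP[? ?]; rewrite mulr_ge0 ?subr_ge0 ?cone_r_ge0. Qed.

Let B_ge0 : 0 <= B.
Proof. by move: s01 => /andP[? ?]; rewrite mulr_ge0 ?cone_r_ge0. Qed.

(** [A] vanishes when s = 1 or [z0] is the tip, and then z lies on the ray of [z1]; symmetrically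
    for [B]. With both positive, [cos_gap_le0] forces the angles to add up. *)
Lemma between_cases z : between z -> 0 < cone_r z ->
  cone_r z ^+ 2 = A ^+ 2 + B ^+ 2 + 2 * A * B * cos t /\
  [\/ A = 0 /\ cone_angle z z1 = 0,
      A != 0 /\ cone_angle z0 z = 0 /\ B = 0 |
      [/\ A != 0, B != 0,
        cone_r z * cos (cone_angle z0 z) = A + B * cos t &
        cone_angle z0 z + cone_angle z z1 = t]].
Proof.
move=> /between_eq h r0.
have [A0|A0] := eqVneq A 0.
  rewrite A0 in h *; have [|rB b0] := @one_sided_gap R B (cone_angle z z1) _ B_ge0 r0
    (cone_angle_itv _ _).
    by rewrite -[RHS]h; ring.
  by split; [rewrite rB; ring|apply: Or31].
have [B0|B0] := eqVneq B 0.
  rewrite B0 in h *; have [|rA a0] := @one_sided_gap R A (cone_angle z0 z) _ A_ge0 r0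
    (cone_angle_itv _ _).
    by rewrite -[RHS]h; ring.
  by split; [rewrite rA; ring|apply: Or32].
have [] := @cos_gap_le0 R A B (cone_angle z0 z) (cone_angle z z1) t (cone_r z).
- by rewrite lt_neqAle eq_sym A0 A_ge0.
- by rewrite lt_neqAle eq_sym B0 B_ge0.
- exact: cone_angle_itv.
- exact: cone_angle_itv.
- exact: cone_angle_itv.
- exact: cone_angle_triangle.
- exact: r0.
- by rewrite h.
by move=> h1 h2 h3; split=> //; apply: Or33; split.
Qed.

Lemma sqr_between_r z : between z -> cone_r z ^+ 2 =
  (1 - s) * cone_r z0 ^+ 2 + s * cone_r z1 ^+ 2
    - s * (1 - s) * dcone z0 z1 ^+ 2.
Proof.
move=> bz; rewrite -sqr_speed.
have [r0|r0] := eqVneq (cone_r z) 0.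
  by have := between_eq bz; rewrite r0 expr0n mulr0 mul0r subrr add0r.
by have [] := between_cases bz; first by rewrite lt_neqAle eq_sym r0 cone_r_ge0.
Qed.

Lemma between_unique z w : between z -> between w -> z = w.
Proof.
move=> bz bw; have rE : cone_r z = cone_r w.
  by apply/eqP; rewrite -(@eqrXn2 _ 2) ?cone_r_ge0// (sqr_between_r bz)// (sqr_between_r bw).
apply: cone_eqP => // r0.
have rz : 0 < cone_r z by rewrite lt_neqAle eq_sym r0 cone_r_ge0.
have rw : 0 < cone_r w by rewrite -rE.
have [r2 cz] := between_cases bz rz; have [_ cw] := between_cases bw rw.
case: cz => [[A0 z1E]|[A0 [z0E B0]]|[A0 B0 cz tz]].
- case: cw => [[_ w1E]|[/eqP//]|[/eqP//]].
  by rewrite (cone_angle_eq0 z1E) (cone_angle_eq0 w1E).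
- case: cw => [[/eqP]|[_ [w0E _]]|[_ /eqP//]]; first by rewrite (negPf A0).
  by rewrite -(cone_angle_eq0 z0E) -(cone_angle_eq0 w0E).
case: cw => [[/eqP]|[_ [_ /eqP]]|[_ _ cw tw]]; rewrite ?(negPf A0) ?(negPf B0)//.
have aE : cone_angle z0 z = cone_angle z0 w.
  apply: cos_inj; rewrite ?in_itv/= ?cone_angle_itv//.
  by apply: (mulfI r0); rewrite cz rE cw.
have bE : cone_angle z z1 = cone_angle w z1.
  by apply: (addrI (cone_angle z0 z)); rewrite tz aE tw.
(* Below pi no cap is active, so angles are Euclidean distances, and equality in the triangle
   inequality fixes the base point on the segment. *)
have [tpi|tpi] := ltP t pi.
  have seg v : cone_angle z0 v + cone_angle v z1 = t ->
      t *: (\val (cone_x v) - \val (cone_x z0)) =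
      cone_angle z0 v *: (\val (cone_x z1) - \val (cone_x z0)).
    have uncap y y' : cone_angle y y' <= t ->
        cone_angle y y' = enorm (\val (cone_x y') - \val (cone_x y)).
      move=> yt; have := le_lt_trans yt tpi; rewrite /cone_angle enorm_distC.
      by set e := enorm _; case: (leP e pi) => // _; rewrite ltxx.
    have := cone_angle_itv z0 v; have := cone_angle_itv v z1.
    move=> /andP[b0 _] /andP[a0 _] tv.
    have av : cone_angle z0 v = enorm (\val (cone_x v) - \val (cone_x z0)).
      by apply: uncap; rewrite -tv lerDl.
    have bv : cone_angle v z1 = enorm (\val (cone_x z1) - \val (cone_x v)).
      by apply: uncap; rewrite -tv lerDr.
    have tE : t = enorm (\val (cone_x z1) - \val (cone_x z0)) by exact: uncap.
    by rewrite tE av; apply: enorm_segment; rewrite -av -bv -tE.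
  have [t0|t0] := eqVneq t 0.
    have /eqP := tz; rewrite t0 paddr_eq0; first last.
    - by have /andP[] := cone_angle_itv z z1.
    - by have /andP[] := cone_angle_itv z0 z.
    move=> /andP[/eqP a0 _]; rewrite -(cone_angle_eq0 a0).
    by rewrite aE in a0; rewrite -(cone_angle_eq0 a0).
  apply/val_inj/(addIr (- \val (cone_x z0)))/(scalerI t0).
  by rewrite !seg// aE.
have tE : t = pi.
  by apply/eqP; rewrite eq_le tpi; have /andP[_ ->] := cone_angle_itv z0 z1.
(* At angle pi the radius is |A - B|, so the cosine is 1 or -1: the point lies on the ray of [z0] or
   on that of [z1]. *)
have : `|cos (cone_angle z0 z)| == 1.
  rewrite -sqrp_eq1// real_normK ?num_real//.
  have : cone_r z ^+ 2 * cos (cone_angle z0 z) ^+ 2 = cone_r z ^+ 2 * 1.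
    by rewrite mulr1 -exprMn cz r2 tE cospi; ring.
  by move/(mulfI _) => ->//; rewrite sqrf_eq0.
rewrite norm_cos_eq1 => sa.
have /orP[/eqP a0|/eqP api] : (cone_angle z0 z == 0) || (cone_angle z0 z == pi).
  have /andP[a0 api] := cone_angle_itv z0 z.
  rewrite !eq_le a0 api !andbT orbC; apply/orP; rewrite !leNgt.
  apply/orP; rewrite -negb_and; apply/negP => /andP[h1 h2].
  by have := @sin_gt0_pi _ (cone_angle z0 z); rewrite h1 h2 (eqP sa) ltxx => /(_ isT).
  rewrite -(cone_angle_eq0 a0).
  by rewrite aE in a0; rewrite -(cone_angle_eq0 a0).
have b0 : cone_angle z z1 = 0.
  by apply: (addrI (cone_angle z0 z)); rewrite tz tE api addr0.
rewrite (cone_angle_eq0 b0).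
by rewrite bE in b0; rewrite (cone_angle_eq0 b0).
Qed.

End between.

Section explicit_geodesic.
Context (z0 z1 : cone ne).
Local Notation t := (cone_angle z0 z1).
Local Notation x0 := (\val (cone_x z0) : 'rV[R]_d).
Local Notation x1 := (\val (cone_x z1) : 'rV[R]_d).

(* The polar coordinates of (1 - s) r0 + s r1 exp(i t). The minimum with t only
   matters at radius 0, where the argument of acos is the junk value 0; likewise
   geod_angle / t is 0 when t = 0. *)
Definition geod_r s : R := Num.sqrt
  (((1 - s) * cone_r z0) ^+ 2 + (s * cone_r z1) ^+ 2
    + 2 * ((1 - s) * cone_r z0) * (s * cone_r z1) * cos t).

Definition geod_angle s : R := Num.min t
  (acos (((1 - s) * cone_r z0 + s * cone_r z1 * cos t) / geod_r s)).

Definition geod_vec s : 'rV[R]_d := x0 + (geod_angle s / t) *: (x1 - x0).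

(** The default of [insubd] is never taken for s in [0,1] when [Omega] is convex
    ([geod_vec_dom]). *)
Definition geod_x s : dom ne :=
  insubd (cone_x z0 : set_type Omega) (geod_vec s).

Definition geod s : cone ne :=
  cone_pt (geod_x s) (NngNum (sqrtr_ge0 _ : 0 <= geod_r s)).

End explicit_geodesic.

End cone_geometry.

(** * Existence of cone geodesics *)

Section geodesic_existence.
Context (R : realType) (d : nat) (Omega : set 'rV[R]_d) (ne : Omega !=set0).
Hypothesis Omega_convex : convex_set Omega.
Implicit Types (z w : cone ne) (s u : R).
Context (z0 z1 : cone ne).
Local Notation t := (cone_angle z0 z1).
Local Notation x0 := (\val (cone_x z0) : 'rV[R]_d).
Local Notation x1 := (\val (cone_x z1) : 'rV[R]_d).
Local Notation geod_r := (geod_r z0 z1).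
Local Notation geod_angle := (geod_angle z0 z1).
Local Notation geod := (geod z0 z1).
Local Notation geod_vec := (geod_vec z0 z1).

Lemma geod_polar s : 0 <= s <= 1 ->
  [/\ geod_r s * cos (geod_angle s)
        = (1 - s) * cone_r z0 + s * cone_r z1 * cos t,
      geod_r s * sin (geod_angle s) = s * cone_r z1 * sin t
    & 0 <= geod_angle s <= t].
Proof.
move=> /andP[s0 s1]; apply: polar_sum => //.
- by rewrite mulr_ge0 ?subr_ge0 ?cone_r_ge0.
- by rewrite mulr_ge0 ?cone_r_ge0.
- exact: cone_angle_itv.
Qed.

Lemma geod_vec_dom s : 0 <= s <= 1 -> geod_vec s \in Omega.
Proof.
move=> s01; have [_ _ /andP[a0 at_]] := geod_polar s01.
have k0 : 0 <= geod_angle s / t by rewrite divr_ge0 ?(le_trans a0).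
have k1 : geod_angle s / t <= 1.
  have [->|t0] := eqVneq t 0; first by rewrite invr0 mulr0.
  by rewrite ler_pdivrMr ?mul1r// lt_neqAle eq_sym t0 (le_trans a0).
have -> : geod_vec s = conv (Itv01 k0 k1) (x1 : convex_lmodType 'rV[R]_d) x0.
  rewrite /conv /= /geod_vec scalerBr scalerBl scale1r /unstable.onem.
  by rewrite [RHS]addrCA addrA.
by apply: Omega_convex; apply: valP.
Qed.

Lemma cone_r_geod s : cone_r (geod s) = geod_r s.
Proof. exact: (cone_ptP _ _).1. Qed.

Lemma val_cone_x_geod s : 0 <= s <= 1 -> geod_r s != 0 ->
  \val (cone_x (geod s)) = geod_vec s.
Proof.
move=> s01 r0; rewrite (cone_ptP _ _).2//; rewrite /geod_x.
by rewrite insubdK// geod_vec_dom.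
Qed.

Lemma cos_pi_geod s u : 0 <= s <= 1 -> 0 <= u <= 1 ->
  cone_r (geod s) * cone_r (geod u) * cos (cone_angle (geod s) (geod u))
  = geod_r s * geod_r u * cos (geod_angle s - geod_angle u).
Proof.
move=> s01 u01; rewrite !cone_r_geod.
have [->|rs] := eqVneq (geod_r s) 0; first by rewrite !mul0r.
have [->|ru] := eqVneq (geod_r u) 0; first by rewrite mulr0 !mul0r.
congr (_ * _); rewrite /cone_angle !val_cone_x_geod// /geod_vec.
rewrite opprD addrACA subrr add0r -scalerBl -mulrBl enormZ.
have [cs ss /andP[as0 ast]] := geod_polar s01.
have [cu su /andP[au0 aut]] := geod_polar u01.
rewrite (enorm_distC x1) normrM normfV.
have tE : t = Num.min (enorm (x0 - x1)) pi by [].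
(* When the cap is active, distances between base points are no longer angles. But sin t = 0 then
   leaves only the angles 0 and pi at nonzero radius, and the base point is one of the two ends. *)
have [/ltW thpi|thpi] := ltP (enorm (x0 - x1)) pi; last first.
  have tpi : t = pi by rewrite tE; apply/min_idPr.
  have zero_or_pi v : geod_r v != 0 -> 0 <= geod_angle v <= t ->
      geod_r v * sin (geod_angle v) = v * cone_r z1 * sin t ->
      geod_angle v = 0 \/ geod_angle v = pi.
    rewrite tpi sinpi mulr0 => rv /andP[a0 api] /eqP.
    rewrite mulf_eq0 (negPf rv) /= => sa.
    have [?|h0] := eqVneq (geod_angle v) 0; [by left|right].
    apply/eqP; rewrite eq_le api leNgt; apply/negP => h1.
    have := @sin_gt0_pi _ (geod_angle v).
    by rewrite lt_neqAle eq_sym h0 a0 h1 (eqP sa) ltxx => /(_ isT).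
  have pp : `|pi| = pi :> R by rewrite ger0_norm// pi_ge0.
  have pn0 : pi != 0 :> R by rewrite gt_eqF// pi_gt0.
  have p0 := pi_ge0 R.
  have as_ : 0 <= geod_angle s <= t by rewrite as0.
  have au_ : 0 <= geod_angle u <= t by rewrite au0.
  case: (zero_or_pi s rs as_ ss) => ->; case: (zero_or_pi u ru au_ su) => ->;
  rewrite tpi ?pp.
  - by rewrite subrr normr0 !mul0r min_l.
  - by rewrite sub0r normrN pp mulfV// mul1r min_r// cosN.
  - by rewrite subr0 pp mulfV// mul1r min_r.
  - by rewrite subrr normr0 !mul0r min_l.
have tth : t = enorm (x0 - x1) by rewrite tE; apply/min_idPl.
have t0 : 0 <= t by rewrite tth enorm_ge0.
have cosn (k : R) : cos `|k| = cos k.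
  by case: (ger0P k) => // _; rewrite cosN.
have [tz|tz] := eqVneq t 0.
  have -> : geod_angle s = 0 by apply/eqP; rewrite eq_le as0 -tz ast.
  have -> : geod_angle u = 0 by apply/eqP; rewrite eq_le au0 -tz aut.
  by rewrite subrr normr0 !mul0r min_l// pi_ge0.
rewrite -tth (ger0_norm t0) divfK// min_l ?cosn//.
rewrite ler_norml; have tpi : t <= pi by rewrite tth.
by apply/andP; split; lra.
Qed.

(** By the law of cosines this is the distance between two points of the planar segment from r0 to
    r1 exp(i t). *)
Lemma dcone_geod s u : 0 <= s <= 1 -> 0 <= u <= 1 ->
  dcone (geod s) (geod u) = `|s - u| * dcone z0 z1.
Proof.
move=> s01 u01; apply/eqP.
rewrite -(@eqrXn2 _ 2) ?mulr_ge0 ?dcone_ge0//; apply/eqP.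
have [cs ss _] := geod_polar s01; have [cu su _] := geod_polar u01.
rewrite sqr_dcone -!mulrA (mulrA (cone_r _)) cos_pi_geod// !cone_r_geod.
rewrite exprMn real_normK ?num_real// sqr_dcone cosB.
have -> : geod_r s * geod_r u * (cos (geod_angle s) * cos (geod_angle u) +
    sin (geod_angle s) * sin (geod_angle u)) =
  (geod_r s * cos (geod_angle s)) * (geod_r u * cos (geod_angle u)) +
  (geod_r s * sin (geod_angle s)) * (geod_r u * sin (geod_angle u)) by ring.
have gr2 v : 0 <= v <= 1 -> geod_r v ^+ 2 =
    ((1 - v) * cone_r z0 + v * cone_r z1 * cos t) ^+ 2 +
    (v * cone_r z1 * sin t) ^+ 2.
  move=> /geod_polar[<- <- _]; rewrite !exprMn sin2cos2; ring.
rewrite !gr2// cs ss cu su.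
transitivity ((((1 - s) * cone_r z0 + s * cone_r z1 * cos t) -
   ((1 - u) * cone_r z0 + u * cone_r z1 * cos t)) ^+ 2 +
   (s - u) ^+ 2 * cone_r z1 ^+ 2 * sin t ^+ 2); first by ring.
rewrite sin2cos2; ring.
Qed.

Lemma geod0 : geod 0 = z0.
Proof.
have s01 : 0 <= (0 : R) <= 1 by rewrite lexx ler01.
have r0 : geod_r 0 = cone_r z0.
  rewrite /geod_r subr0 mul1r !mul0r mulr0 mul0r expr0n !addr0 sqrtr_sqr.
  by rewrite ger0_norm// cone_r_ge0.
apply: cone_eqP; rewrite ?cone_r_geod// r0 => rn0.
apply/val_inj; rewrite val_cone_x_geod ?r0// /geod_vec /geod_angle r0.
rewrite subr0 !mul1r !mul0r addr0 mulfV// acos1 min_r; last first.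
  by have /andP[] := cone_angle_itv z0 z1.
by rewrite mul0r scale0r addr0.
Qed.

Lemma geod1 : geod 1 = z1.
Proof.
have s01 : 0 <= (1 : R) <= 1 by rewrite lexx ler01.
have r1 : geod_r 1 = cone_r z1.
  rewrite /geod_r subrr mul1r !mul0r mulr0 !mul0r expr0n add0r addr0 sqrtr_sqr.
  by rewrite ger0_norm// cone_r_ge0.
apply: cone_eqP; rewrite ?cone_r_geod// r1 => rn0.
apply/val_inj; rewrite val_cone_x_geod ?r1// /geod_vec /geod_angle r1.
rewrite subrr !mul1r !mul0r add0r [X in acos X]mulrAC mulfV// mul1r cosK; last first.
  by rewrite in_itv/= cone_angle_itv.
rewrite minxx; have [t0|t0] := eqVneq t 0.
  by rewrite t0 mul0r scale0r addr0 (cone_angle_eq0 t0).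
by rewrite mulfV// scale1r addrC subrK.
Qed.

Lemma geod_geodesic : is_geodesic (@dcone R d Omega ne) geod.
Proof. by move=> s u s01 u01; rewrite geod0 geod1 dcone_geod. Qed.

End geodesic_existence.

(** * Uniqueness of cone geodesics *)

Section geodesics.
Context (R : realType) (d : nat) (Omega : set 'rV[R]_d) (ne : Omega !=set0).
Hypothesis Omega_convex : convex_set Omega.
Implicit Types (z w : cone ne) (y : R -> cone ne) (s u : R).

Lemma geodesic_between y s : is_geodesic (@dcone R d Omega ne) y ->
  0 <= s <= 1 -> between s (y 0) (y 1) (y s).
Proof.
move=> yg /andP[s0 s1]; split.
  by rewrite yg ?lexx ?ler01 ?s0// sub0r normrN ger0_norm.
by rewrite yg ?lexx ?ler01 ?s0// distrC ger0_norm// subr_ge0.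
Qed.

Lemma geodesic_eq y s : is_geodesic (@dcone R d Omega ne) y ->
  0 <= s <= 1 -> y s = geod (y 0) (y 1) s.
Proof.
move=> yg s01; apply: (@between_unique _ _ _ _ s (y 0) (y 1)) => //.
  exact: geodesic_between.
have := geodesic_between (geod_geodesic Omega_convex (y 0) (y 1)) s01.
by rewrite geod0// geod1.
Qed.

Lemma cone_geodP z0 z1 :
  [/\ is_geodesic (@dcone R d Omega ne) (cone_geod z0 z1),
    cone_geod z0 z1 0 = z0 & cone_geod z0 z1 1 = z1].
Proof.
rewrite /cone_geod; case: xgetP => [y _ //|/(_ (geod z0 z1))].
by case; split; [exact: geod_geodesic|exact: geod0|exact: geod1].
Qed.

Lemma cone_geodE z0 z1 s : 0 <= s <= 1 ->
  cone_geod z0 z1 s = geod z0 z1 s.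
Proof.
by have [yg y0 y1] := cone_geodP z0 z1; move=> /(geodesic_eq yg); rewrite y0 y1.
Qed.

End geodesics.

(** * Topology of the base *)

Section dom_topology.
Context (R : realType) (d : nat) (Omega : set 'rV[R]_d) (ne : Omega !=set0).
Implicit Types (phi : dom ne -> R) (x : dom ne).

(** The topology comes from the sup norm, which the Euclidean norm dominates, so Euclidean balls fit
    into neighbourhoods. *)
Lemma dom_nbhs_ball x (U : set (dom ne)) : nbhs x U ->
  exists2 e : R, 0 < e & forall x', enorm (\val x - \val x') < e -> U x'.
Proof.
rewrite nbhsE => -[V [[W oW WV] Vx] VU].
have : nbhs (\val x : 'rV[R]_d) W.
  by apply: open_nbhs_nbhs; split => //; move: Vx; rewrite -WV.
move=> /nbhs_ballP[e /= e0 eW]; exists e => // x' xx'.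
apply: VU; rewrite -WV; apply: eW; split=> // i j; rewrite ord1 /ball /=.
by have := le_coord_enorm (\val x - \val x') j; rewrite !mxE => /le_lt_trans; apply.
Qed.

Lemma dom_continuous_ball phi x (e : R) : continuous phi -> 0 < e ->
  exists2 e' : R, 0 < e' &
    forall x', enorm (\val x - \val x') < e' -> `|phi x - phi x'| < e.
Proof.
move=> cphi e0; apply: (@dom_nbhs_ball x [set x' | `|phi x - phi x'| < e]).
by have /cvgrPdist_lt/(_ e e0) := cphi x.
Qed.

Lemma continuous_dom_val : continuous (\val : dom ne -> 'rV[R]_d).
Proof. exact: (@initial_continuous (set_type Omega) 'rV[R]_d set_val). Qed.

Lemma continuous_dom_coord i : continuous (fun x : dom ne => (\val x : 'rV[R]_d) ord0 i).
Proof.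
move=> x; apply: (@continuous_comp (dom ne) 'rV[R]_d R _ (fun v => v ord0 i)).
  exact: continuous_dom_val.
exact: coord_continuous.
Qed.

Lemma continuous_dom_enorm (c : 'rV[R]_d) :
  continuous (fun x : dom ne => enorm (\val x - c)).
Proof.
move=> x; apply: (@continuous_comp (dom ne) R R _ Num.sqrt); last exact: sqrt_continuous.
apply: continuous_big; first exact: pseudometric_normed_Zmodule.add_continuous.
move=> i _ {}x.
under [X in continuous_at x X]eq_fun do rewrite !mxE.
apply: (@continuous_comp (dom ne) R R _ (fun r => (r - c ord0 i) ^+ 2)).
  exact: continuous_dom_coord.
apply: (@continuous_comp R R R _ (fun r => r ^+ 2)); last exact: exprn_continuous.
by apply: cvgB; [exact: cvg_id|exact: cvg_cst].
Qed.

Hypothesis Omega_compact : compact Omega.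

Lemma dom_continuous_bounded phi : continuous phi ->
  exists2 M : R, 0 <= M & forall x, `|phi x| <= M.
Proof.
move=> cphi; pose f v := phi (insubd ((point : dom ne) : set_type Omega) v).
have fE : sigL Omega f = phi.
  by apply/funext => x; rewrite /sigL /f /= valKd.
have cf : {within Omega, continuous f}.
  by apply/subspace_sigL_continuousP; rewrite fE.
have /(@compact_bounded R R^o) := continuous_compact cf Omega_compact.
move=> [M [_ /(_ (`|M| + 1))]]; rewrite (le_lt_trans (ler_norm _)) ?ltrDl//.
move=> /(_ isT) fM; exists (`|M| + 1); first by rewrite addr_ge0.
move=> x; have -> : phi x = f (\val x) by rewrite /f valKd.
by apply: fM; exists (\val x) => //; exact/set_mem/(valP x).
Qed.

End dom_topology.

(** * Continuity and Borel measurability on the cone *)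

Section cone_measurability.
Context (R : realType) (d : nat) (Omega : set 'rV[R]_d) (ne : Omega !=set0).
Implicit Types (phi : dom ne -> R) (z w : cone ne).

Lemma one_sub_cos_le (a : R) : 0 <= a -> 1 - cos a <= a.
Proof.
rewrite le_eqVlt => /predU1P[<-|a0]; first by rewrite cos0 subrr.
have cc : {within `[0, a], continuous (@cos R)}.
  by apply: continuous_subspaceT; exact: continuous_cos.
have dc x : x \in `]0, a[ -> is_derive x 1 (@cos R) (- sin x).
  by move=> _; exact: is_derive_cos.
have [c _] := MVT a0 dc cc.
rewrite cos0 subr0 => h; have s1 := sin_le1 c.
have : sin c * a <= 1 * a by rewrite ler_pM2r.
by move: h; rewrite mulNr; lra.
Qed.

Lemma sqr_dconeE z w : dcone z w ^+ 2 = (cone_r z - cone_r w) ^+ 2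
  + 2 * (cone_r z * cone_r w * (1 - cos (cone_angle z w))).
Proof. rewrite sqr_dcone; ring. Qed.

Lemma dcone_r z w : `|cone_r z - cone_r w| <= dcone z w.
Proof.
rewrite -(@ler_pXn2r _ 2) ?nnegrE ?dcone_ge0// real_normK ?num_real//.
have c1 := cos_le1 (cone_angle z w); rewrite sqr_dconeE lerDl.
by apply: mulr_ge0 => //; apply: mulr_ge0; rewrite ?subr_ge0// mulr_ge0 ?cone_r_ge0.
Qed.

Lemma dcone_angle z (e : R) : cone_r z != 0 -> 0 < e ->
  exists2 e' : R, 0 < e' &
    forall w, dcone z w < e' -> enorm (\val (cone_x z) - \val (cone_x w)) < e.
Proof.
move=> rn0 e0; have r0 : 0 < cone_r z by rewrite lt_neqAle eq_sym rn0 cone_r_ge0.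
pose a := Num.min e pi; have a0 : 0 < a by rewrite lt_min e0 pi_gt0.
have api : a <= pi by rewrite ge_min lexx orbT.
pose c := 1 - cos a.
have c0 : 0 < c.
  by rewrite subr_gt0 -(cos0 R) ltr_cos// in_itv/= ?lexx ?pi_ge0// (ltW a0).
have c2 : c <= 2 by have := cos_geN1 a; rewrite /c; lra.
(* As [c <= 2], this is at most half the radius of z. Hence w keeps at least half that radius, and
   the squared distance bounds 1 - cos of the angle strictly below [c]. *)
exists (cone_r z * c / 4) => [|w dw]; first by rewrite divr_gt0 ?mulr_gt0.
have rw : cone_r z / 2 <= cone_r w.
  have := le_lt_trans (dcone_r z w) dw.
  have : cone_r z * c <= cone_r z * 2 by rewrite ler_pM2l.
  move=> h1 /ltr_normlP[h2 h3]; lra.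
have h : cone_r z ^+ 2 * (1 - cos (cone_angle z w)) < cone_r z ^+ 2 * c.
  have d2 : dcone z w ^+ 2 < (cone_r z * c / 4) ^+ 2.
    by rewrite ltr_pXn2r ?nnegrE ?dcone_ge0// divr_ge0 ?mulr_ge0 ?(ltW r0) ?(ltW c0).
  have h1 : cone_r z * (1 - cos (cone_angle z w)) * (cone_r z / 2) <=
      cone_r z * (1 - cos (cone_angle z w)) * cone_r w.
    by apply: ler_wpM2l => //; rewrite mulr_ge0 ?(ltW r0)// subr_ge0 cos_le1.
  have h2 := sqr_ge0 (cone_r z - cone_r w).
  have h3 : cone_r z ^+ 2 * c * c <= cone_r z ^+ 2 * c * 2.
    by rewrite ler_pM2l// mulr_gt0// exprn_gt0.
  have h4 : 0 <= cone_r z ^+ 2 * c by rewrite mulr_ge0 ?(ltW c0)// exprn_ge0 // ltW.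
  rewrite sqr_dconeE in d2; lra.
have : cone_angle z w < a.
  rewrite -ltr_cos ?in_itv/= ?cone_angle_itv ?(ltW a0)//.
  by move: h; rewrite ltr_pM2l ?exprn_gt0// /c; lra.
rewrite /cone_angle lt_min !gt_min => /andP[/orP[//|pe] /orP[h1|]].
  exact: lt_trans h1 pe.
by rewrite ltxx.
Qed.

Lemma dist_open_measurable (U : set (cone ne)) :
  dist_open (@dcone R d Omega ne) U -> measurable (U : set (coneB ne)).
Proof. exact: sub_sigma_algebra. Qed.

Lemma dcone_continuous_measurable (f : cone ne -> R) :
  (forall z (e : R), 0 < e -> exists2 e' : R, 0 < e' &
    forall w, dcone z w < e' -> `|f z - f w| < e) ->
  measurable_fun [set: coneB ne] f.
Proof.
move=> cf; apply: (measurability _ (RGenOInfty.measurableE R)) => _ [_ [x ->] <-].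
rewrite setTI; apply: dist_open_measurable => z /=; rewrite in_itv/= andbT => xz.
have [|e' e0 fe] := cf z (f z - x); first by rewrite subr_gt0.
exists e' => // w /fe /ltr_normlP[h1 h2]; rewrite /= in_itv/= andbT; lra.
Qed.

Lemma measurable_cone_r : measurable_fun [set: coneB ne] (@cone_r R d Omega ne).
Proof.
apply: dcone_continuous_measurable => z e e0; exists e => // w.
exact: le_lt_trans (dcone_r _ _).
Qed.

Lemma continuous_measurable_dom phi : continuous phi ->
  measurable_fun [set: domB ne] phi.
Proof.
move=> /continuousP cphi.
apply: (measurability _ (RGenOpens.measurableE R)) => _ [_ [a [b ->] <-]].
by rewrite setTI; apply: sub_sigma_algebra; apply: cphi; exact: interval_open.
Qed.

Hypothesis Omega_compact : compact Omega.

Lemma measurable_cone_fun phi : continuous phi ->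
  measurable_fun [set: coneB ne] (cone_fun phi).
Proof.
move=> cphi; have [M M0 phiM] := dom_continuous_bounded Omega_compact cphi.
apply: dcone_continuous_measurable => z e e0; rewrite /cone_fun.
have M1 : 0 < M + 1 by rewrite ltr_wpDl.
(* Near the tip the base point is uncontrolled; boundedness of [phi] and the vanishing factor r^2
   replace continuity. *)
have [rz|rz] := eqVneq (cone_r z) 0.
  exists (Num.min 1 (e / (M + 1))); first by rewrite lt_min ltr01 divr_gt0.
  move=> w; have := dcone_r z w; rewrite rz !sub0r expr0n mul0r sub0r !normrN.
  move=> rd; rewrite lt_min => /andP[d1 de].
  have r0 := cone_r_ge0 w; rewrite (ger0_norm r0) in rd.
  rewrite normrM ger0_norm ?sqr_ge0//.
  have h1 : cone_r w * cone_r w <= cone_r w * 1.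
    by apply: ler_wpM2l => //; lra.
  have h2 : cone_r w ^+ 2 * `|phi (cone_x w)| <= cone_r w ^+ 2 * M.
    by apply: ler_wpM2l => //; exact: sqr_ge0.
  have h3 : cone_r w ^+ 2 * M <= cone_r w * M by apply: ler_wpM2r; rewrite // expr2; lra.
  have : cone_r w * (M + 1) < e.
    by rewrite -ltr_pdivlMr//; exact: le_lt_trans rd de.
  lra.
have r0 : 0 < cone_r z by rewrite lt_neqAle eq_sym rz cone_r_ge0.
have [|e1 e10 h1] := @dom_continuous_ball _ _ _ _ phi (cone_x z) (e / (2 * cone_r z ^+ 2)) cphi.
  by rewrite divr_gt0// mulr_gt0// exprn_gt0.
have [e2 e20 h2] := dcone_angle rz e10.
(* The radii sum to at most 3 times that of z, so the radial term is at most
   [e3 * (3 * cone_r z * (M + 1))], that is e / 2. *)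
pose e3 := e / (6 * cone_r z * (M + 1)).
have e30 : 0 < e3 by rewrite divr_gt0// !mulr_gt0.
exists (Num.min e2 (Num.min e3 (cone_r z))); first by rewrite !lt_min e20 e30 r0.
move=> w; rewrite !lt_min => /andP[d2 /andP[d3 dr]].
have hphi := h1 _ (h2 _ d2).
have -> : cone_r z ^+ 2 * phi (cone_x z) - cone_r w ^+ 2 * phi (cone_x w) =
  cone_r z ^+ 2 * (phi (cone_x z) - phi (cone_x w)) +
  (cone_r z - cone_r w) * ((cone_r z + cone_r w) * phi (cone_x w)) by ring.
apply: le_lt_trans (ler_normD _ _) _.
have rd := dcone_r z w; have rw0 := cone_r_ge0 w.
have -> : e = e / 2 + e / 2 by lra.
apply: ltr_leD.
  rewrite normrM ger0_norm ?sqr_ge0// -ltr_pdivlMl ?exprn_gt0//.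
  by apply: lt_le_trans hphi _; rewrite invfM mulrA mulrC.
have rw : cone_r w <= 2 * cone_r z.
  by have /ler_normlP[] := le_trans rd (ltW dr); lra.
rewrite !normrM (ger0_norm (addr_ge0 (ltW r0) rw0)).
have -> : e / 2 = e3 * (3 * cone_r z * (M + 1)).
  by rewrite /e3; field; rewrite !gt_eqF.
apply: ler_pM; rewrite ?mulr_ge0 ?addr_ge0 ?cone_r_ge0//.
  by apply: le_trans rd (ltW d3).
apply: ler_pM; rewrite ?addr_ge0 ?cone_r_ge0//; first lra.
by have := phiM (cone_x w); lra.
Qed.

End cone_measurability.

(** * Measurable real functions *)

Section real_measurability.
Context (R : realType).

Lemma measurable_invr : measurable_fun [set: R] (@GRing.inv R).
Proof.
rewrite (_ : @GRing.inv R = fun r => if r == 0 then 0 else r^-1); last first.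
  by apply/funext => r; case: eqP => // ->; rewrite invr0.
apply: measurable_fun_if => //; first exact: measurable_fun_eqr.
have -> : [set: R] `&` (fun r : R => r == 0) @^-1` [set false] = [set r | r != 0].
  by rewrite setTI; apply/seteqP; split=> r /=; [move/negbT|move/negPf].
apply: open_continuous_measurable_fun; first exact: open_neq.
by move=> r; rewrite inE /= => r0; exact: inv_continuous.
Qed.

(** Outside [-1,1] the set from which [acos] picks a value is empty, so all results are one default,
    written [acos 2]. *)
Lemma acos_out (x : R) : ~~ (-1 <= x <= 1) -> acos x = acos 2.
Proof.
have out (y : R) : ~~ (-1 <= y <= 1) -> [set a | 0 <= a <= pi /\ cos a = y] = set0.
  move=> yN; apply/seteqP; split=> // a [_ ay].
  by move: yN; rewrite -ay cos_geN1 cos_le1.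
move=> xN; rewrite unlock !out//.
by apply/negP => /andP[_]; rewrite leNgt ltr1n.
Qed.

Lemma measurable_acos : measurable_fun [set: R] (@acos R).
Proof.
rewrite (_ : @acos R = fun x => if (-1 < x) && (x < 1) then acos x else
   if x == 1 then acos 1 else if x == -1 then acos (-1) else acos 2); last first.
  apply/funext => x; case: ifPn => // xN.
  case: eqP => [->//|/eqP x1]; case: eqP => [->//|/eqP xN1].
  apply: acos_out; apply: contra xN => /andP[h1 h2].
  by rewrite !lt_neqAle h1 h2 x1 eq_sym xN1.
have mand : measurable_fun [set: R] (fun x : R => (-1 < x) && (x < 1)).
  by apply: measurable_and; exact: measurable_fun_ltr.
apply: measurable_fun_if => //.
  have -> : [set: R] `&` (fun x : R => (-1 < x) && (x < 1)) @^-1` [set true]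
      = `]-1, 1[%classic.
    by rewrite setTI; apply/seteqP; split=> x /=; rewrite in_itv.
  apply: open_continuous_measurable_fun; first exact: interval_open.
  by move=> x; rewrite inE /= in_itv/= => x1; exact: continuous_acos.
apply: measurable_funTS; apply: measurable_fun_ifT => //.
  exact: measurable_fun_eqr.
by apply: measurable_fun_ifT => //; exact: measurable_fun_eqr.
Qed.

Lemma measurable_sqrt : measurable_fun [set: R] (@Num.sqrt R).
Proof. by apply: continuous_measurable_fun; exact: sqrt_continuous. Qed.

Lemma measurable_cos : measurable_fun [set: R] (@cos R).
Proof. by apply: continuous_measurable_fun; exact: continuous_cos. Qed.

Lemma rat_approx (x e : R) : 0 < e -> exists q : rat, `|x - ratr q| < e.
Proof.
move=> e0; have [|q] := @rat_in_itvoo R x (x + e); first by rewrite ltrDl.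
rewrite in_itv/= => /andP[h1 h2]; exists q.
by apply/ltr_normlP; split; lra.
Qed.

End real_measurability.

(** * Coordinates on the cone and measurability of the interpolation map *)

Section cone_coordinates.
Context (R : realType) (d : nat) (Omega : set 'rV[R]_d) (ne : Omega !=set0).
Hypothesis Omega_compact : compact Omega.
Implicit Types (z w : cone ne).

Definition cone_coord i z : R := (\val (cone_x z) : 'rV[R]_d) ord0 i.

(** A coordinate of x need not be continuous at the tip, but r^2 times it is. Dividing by r^2
    recovers it off the tip, and the tip is a single point. *)
Lemma measurable_cone_coord i : measurable_fun [set: coneB ne] (cone_coord i).
Proof.
rewrite (_ : cone_coord i = fun z => if cone_r z == 0
    then cone_coord i (cone_pt point 0%:nng)
    else cone_fun (fun x => (\val x : 'rV[R]_d) ord0 i) z * (cone_r z ^+ 2)^-1).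
  have mr := @measurable_cone_r R d Omega ne.
  apply: measurable_fun_ifT => //; first exact: measurable_fun_eqr.
  apply: measurable_funM.
    by apply: measurable_cone_fun => //; exact: continuous_dom_coord.
  apply: measurableT_comp; first exact: measurable_invr.
  exact: measurable_funX.
apply/funext => z; case: eqP => [r0|/eqP r0].
  by congr cone_coord; apply: cone_eqP; rewrite r0 ?eqxx// (cone_ptP _ _).1.
by rewrite /cone_fun /cone_coord mulrC mulKf// expf_neq0.
Qed.

Lemma enorm_le_sum (u : 'rV[R]_d) : enorm u <= \sum_(i < d) `|u ord0 i|.
Proof.
have s0 : 0 <= \sum_(i < d) `|u ord0 i| by apply: sumr_ge0.
rewrite -(@ler_pXn2r _ 2) ?nnegrE ?enorm_ge0// sqr_enorm [X in _ <= X]expr2 mulr_suml.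
apply: ler_sum => i _; rewrite -expr2 -real_normK ?num_real// expr2.
by apply: ler_wpM2l => //; rewrite (bigD1 i)//= lerDl sumr_ge0.
Qed.

Lemma dcone_coords z (e : R) : 0 < e -> exists2 e' : R, 0 < e' & forall w,
  `|cone_r z - cone_r w| + \sum_(i < d)
     `|cone_r z * cone_coord i z - cone_r w * cone_coord i w| < e' ->
  dcone z w < e.
Proof.
move=> e0.
have [M M0 hM] := dom_continuous_bounded Omega_compact
  (@continuous_dom_enorm R d Omega ne 0).
have r0 := cone_r_ge0 z.
(* [K] bounds r |x - x'| by [K * N], from r (x - x') = (r x - r' x') - x' (r - r') in each
   coordinate. Then [C * N] bounds the squared distance: N <= 1 gives N^2 <= N and r' <= r + 1, and
   1 - cos a <= a. *)
pose K := 1 + M *+ d; pose C := 1 + 2 * (cone_r z + 1) * K.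
have K0 : 0 < K by apply: ltr_pwDl => //; exact: mulrn_wge0.
have C0 : 0 < C.
  by apply: ltr_pwDl => //; apply: mulr_ge0 (ltW K0); apply: mulr_ge0 => //; exact: addr_ge0.
exists (Num.min 1 (e ^+ 2 / C)); first by rewrite lt_min ltr01 divr_gt0 ?exprn_gt0.
move=> w; set S := \sum_(i < d) _; set N := _ + S; rewrite lt_min => /andP[N1 Ne].
have S0 : 0 <= S by apply: sumr_ge0.
have dr0 : 0 <= `|cone_r z - cone_r w| by [].
have N0 : 0 <= N by rewrite addr_ge0.
have rw0 := cone_r_ge0 w.
have rw : cone_r w <= cone_r z + 1.
  have /ler_normlP[] : `|cone_r z - cone_r w| <= 1 by rewrite /N in N1; lra.
  by lra.
have rx : cone_r z * enorm (\val (cone_x z) - \val (cone_x w)) <= K * N.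
  apply: (@le_trans _ _ (S + M *+ d * `|cone_r z - cone_r w|)).
    apply: le_trans (ler_wpM2l r0 (enorm_le_sum _)) _.
    have -> : M *+ d * `|cone_r z - cone_r w| =
        \sum_(i < d) M * `|cone_r z - cone_r w|.
      by rewrite sumr_const card_ord mulrnAl.
    rewrite mulr_sumr -big_split.
    apply: ler_sum => i _ /=; rewrite !mxE -{1}(ger0_norm r0) -normrM.
    have -> : cone_r z * (\val (cone_x z) ord0 i - \val (cone_x w) ord0 i) =
       (cone_r z * cone_coord i z - cone_r w * cone_coord i w) -
       cone_coord i w * (cone_r z - cone_r w) by rewrite /cone_coord; ring.
    apply: le_trans (ler_normB _ _) _; rewrite lerD2l normrM ler_wpM2r//.
    apply: le_trans (le_trans (ler_norm _) (hM (cone_x w))).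
    by rewrite subr0; exact: le_coord_enorm.
  rewrite /K mulrDl mul1r lerD//; first by rewrite lerDr.
  by rewrite ler_wpM2l ?mulrn_wge0// lerDl.
rewrite -(@ltr_pXn2r _ 2) ?nnegrE ?dcone_ge0 ?(ltW e0)// sqr_dconeE.
have : N * C < e ^+ 2 by rewrite -ltr_pdivlMr.
apply: le_lt_trans; rewrite /C (mulrDr N) mulr1; apply: lerD.
  rewrite -real_normK ?num_real//.
  apply: (@le_trans _ _ (N * N)); last by rewrite ler_piMr// ltW.
  by rewrite expr2 ler_pM// lerDl.
have ang : 1 - cos (cone_angle z w) <= enorm (\val (cone_x z) - \val (cone_x w)).
  have /andP[a0 _] := cone_angle_itv z w.
  by apply: le_trans (one_sub_cos_le a0) _; rewrite ge_min lexx.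
have h1 : cone_r w * (cone_r z * (1 - cos (cone_angle z w))) <= cone_r w * (K * N).
  apply: ler_wpM2l => //; apply: le_trans rx; exact: ler_wpM2l.
have h2 : cone_r w * (K * N) <= (cone_r z + 1) * (K * N).
  by apply: ler_wpM2r => //; rewrite mulr_ge0// ltW.
lra.
Qed.

(* An open set is a union of rational boxes in the coordinates (r, r x). *)
Lemma measurable_to_cone d' (T : measurableType d') (f : T -> coneB ne) :
  measurable_fun [set: T] (fun t => cone_r (f t)) ->
  (forall i, measurable_fun [set: T] (fun t => cone_r (f t) * cone_coord i (f t))) ->
  measurable_fun [set: T] f.
Proof.
move=> mr mc.
apply: (@measurability _ _ _ _ setT f (dist_open (@dcone R d Omega ne))) => //.
move=> _ [U oU <-]; rewrite setTI.
pose N (q : {ffun 'I_d -> rat} * rat) z := `|cone_r z - ratr q.2| +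
  \sum_(i < d) `|cone_r z * cone_coord i z - ratr (q.1 i)|.
pose box (q : {ffun 'I_d -> rat} * rat * rat) := [set z | N q.1 z < ratr q.2].
pose F q : set T := if `[< box q `<=` U >] then f @^-1` (box q) else set0.
rewrite (_ : f @^-1` U = \bigcup_q F q).
  apply: countable_bigcupT_measurable => // q; rewrite /F; case: asboolP => // _.
  have mN : measurable_fun [set: T] (fun t => N q.1 (f t)).
    apply: measurable_funD.
      by apply: measurableT_comp => //; apply: measurable_funB.
    apply: measurable_sum => i.
    by apply: measurableT_comp => //; apply: measurable_funB.
  have := measurable_fun_ltr mN (@measurable_cst _ _ T R setT (ratr q.2)).
  by move=> /(_ measurableT [set true]); rewrite setTI; exact.
apply/seteqP; split=> [t Ut|t [q _]]; last first.
  by rewrite /F; case: asboolP => // + ft; exact.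
have [e e0 eU] := oU _ Ut; have [e' e'0 eN] := dcone_coords (f t) e0.
have [rho] := @rat_in_itvoo R 0 (e' / 2) (divr_gt0 e'0 (ltr0Sn _ _)).
rewrite in_itv/= => /andP[rho0 rhoe].
(* The radius and the d coordinates share the error [rho]; passing through the rational centre
   doubles it, which stays below [e']. *)
have eta0 : 0 < ratr rho / d.+1%:R :> R by rewrite divr_gt0.
have [q0 hq0] := rat_approx (cone_r (f t)) eta0.
have [q hq] := choice (fun i => rat_approx (cone_r (f t) * cone_coord i (f t)) eta0).
have Nt : N ([ffun i => q i], q0) (f t) < ratr rho.
  rewrite /N /=; apply: (@lt_le_trans _ _ (ratr rho / d.+1%:R + (ratr rho / d.+1%:R) *+ d)).
    apply: ltr_leD => //; rewrite -[X in _ *+ X](card_ord d) -sumr_const.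
    by apply: ler_sum => i _; rewrite ffunE ltW.
  by rewrite -mulrS -(mulr_natr (ratr rho / _)) divfK.
exists ([ffun i => q i], q0, rho) => //; rewrite /F asboolT// => w wbox.
apply: eU; apply: eN.
apply: (@le_lt_trans _ _ (N ([ffun i => q i], q0) (f t) + N ([ffun i => q i], q0) w)).
  rewrite /N /= addrACA -big_split; apply: lerD.
    rewrite (_ : _ - _ = (cone_r (f t) - ratr q0) - (cone_r w - ratr q0)); last by ring.
    exact: ler_normB.
  apply: ler_sum => i _ /=; set a := cone_r (f t) * _; set b := cone_r w * _.
  set c := ratr _; rewrite (_ : a - b = (a - c) - (b - c)); last by ring.
  exact: ler_normB.
by have := ltrD Nt wbox; move=> /lt_trans; apply => /=; lra.
Qed.

Let mr1 : measurable_fun [set: (coneB ne * coneB ne)%type] (fun p => cone_r p.1).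
Proof. by apply: measurableT_comp => //; exact: measurable_cone_r. Qed.

Let mr2 : measurable_fun [set: (coneB ne * coneB ne)%type] (fun p => cone_r p.2).
Proof. by apply: measurableT_comp => //; exact: measurable_cone_r. Qed.

Let mc1 i : measurable_fun [set: (coneB ne * coneB ne)%type] (fun p => cone_coord i p.1).
Proof. by apply: measurableT_comp => //; exact: measurable_cone_coord. Qed.

Let mc2 i : measurable_fun [set: (coneB ne * coneB ne)%type] (fun p => cone_coord i p.2).
Proof. by apply: measurableT_comp => //; exact: measurable_cone_coord. Qed.

Let mangle : measurable_fun [set: (coneB ne * coneB ne)%type]
  (fun p => cone_angle p.1 p.2).
Proof.
apply: measurable_minr => //; apply: measurableT_comp; first exact: measurable_sqrt.
apply: measurable_sum => i; apply: measurable_funX.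
under eq_fun do rewrite !mxE.
by apply: measurable_funB; [exact: mc1|exact: mc2].
Qed.

Let mcos : measurable_fun [set: (coneB ne * coneB ne)%type]
  (fun p => cos (cone_angle p.1 p.2)).
Proof. by apply: measurableT_comp => //; exact: measurable_cos. Qed.

Lemma measurable_sqr_dcone : measurable_fun [set: (coneB ne * coneB ne)%type]
  (fun p => dcone p.1 p.2 ^+ 2).
Proof.
under eq_fun do rewrite sqr_dcone.
apply: measurable_funB.
  by apply: measurable_funD; exact: measurable_funX.
by do 3 (apply: measurable_funM => //).
Qed.

Hypothesis Omega_convex : convex_set Omega.

Lemma measurable_cone_geod s : 0 <= s <= 1 ->
  measurable_fun [set: (coneB ne * coneB ne)%type]
    (fun p : coneB ne * coneB ne => cone_geod p.1 p.2 s : coneB ne).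
Proof.
move=> s01.
have mA : measurable_fun [set: (coneB ne * coneB ne)%type]
  (fun p => (1 - s) * cone_r p.1) by apply: measurable_funM.
have mB : measurable_fun [set: (coneB ne * coneB ne)%type]
  (fun p => s * cone_r p.2) by apply: measurable_funM.
have mR : measurable_fun [set: (coneB ne * coneB ne)%type]
    (fun p => geod_r p.1 p.2 s).
  apply: measurableT_comp; first exact: measurable_sqrt.
  apply: measurable_funD.
    by apply: measurable_funD; exact: measurable_funX.
  by do 3 (apply: measurable_funM => //).
have mal : measurable_fun [set: (coneB ne * coneB ne)%type]
    (fun p => geod_angle p.1 p.2 s).
  apply: measurable_minr => //; apply: measurableT_comp; first exact: measurable_acos.
  apply: measurable_funM; first by apply: measurable_funD => //; exact: measurable_funM.
  by apply: measurableT_comp => //; exact: measurable_invr.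
apply: measurable_to_cone => [|i].
  by under eq_fun do rewrite cone_geodE// cone_r_geod.
rewrite (_ : (fun p => _) = (fun p : coneB ne * coneB ne => geod_r p.1 p.2 s *
  (cone_coord i p.1 + geod_angle p.1 p.2 s * (cone_angle p.1 p.2)^-1 *
    (cone_coord i p.2 - cone_coord i p.1)))).
  apply: measurable_funM => //; apply: measurable_funD => //; apply: measurable_funM.
    apply: measurable_funM => //.
    by apply: measurableT_comp => //; exact: measurable_invr.
  exact: measurable_funB.
apply/funext => p; rewrite cone_geodE// cone_r_geod.
have [->|r0] := eqVneq (geod_r p.1 p.2 s) 0; first by rewrite !mul0r.
by rewrite /cone_coord val_cone_x_geod// /geod_vec !mxE.
Qed.

End cone_coordinates.

(** * Change of variables, used for both marginals and for interpolated lifts *)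

Section image_measure.
Context d1 d2 (X : measurableType d1) (Y : measurableType d2) (R : realType).
Context (m : {measure set X -> \bar R}) (n : {measure set Y -> \bar R}) (f : X -> Y).
Hypothesis mf : measurable_fun [set: X] f.
Hypothesis nE : forall A, measurable A -> n A = m (f @^-1` A).
Local Open Scope ereal_scope.

Lemma ge0_integral_image (g : Y -> \bar R) : measurable_fun [set: Y] g ->
  (forall y, 0 <= g y) -> \int[n]_y g y = \int[m]_x g (f x).
Proof.
move=> mg g0; rewrite -[RHS](ge0_integral_pushforward mf m measurableT mg)//.
by apply: eq_measure_integral => A mA _; exact: nE.
Qed.

Lemma integrable_image (g : Y -> \bar R) : n.-integrable setT g ->
  m.-integrable setT (fun x => g (f x)).
Proof.
move=> /integrableP[mg gi]; apply/integrableP; split.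
  exact: measurableT_comp.
by rewrite -(@ge0_integral_image (fun y => `|g y|))//; exact: measurableT_comp.
Qed.

Lemma integral_image (g : Y -> \bar R) : n.-integrable setT g ->
  \int[n]_y g y = \int[m]_x g (f x).
Proof.
move=> gi; have mg := measurable_int _ gi.
rewrite -[RHS](integral_pushforward mf mg (integrable_image gi) measurableT).
by apply: eq_measure_integral => A mA _; exact: nE.
Qed.

End image_measure.

(** * Integrability against plans and the cost of optimal ones *)

Section plans.
Context (R : realType) (d : nat) (Omega : set 'rV[R]_d) (ne : Omega !=set0).
Hypothesis Omega_compact : compact Omega.
Implicit Types (la : {finite_measure set (coneB ne) -> \bar R}).
Implicit Types (ga : {measure set (coneB ne * coneB ne)%type -> \bar R}).

Lemma integrable_sqr_cone_r la : second_moment_finite la ->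
  la.-integrable setT (fun z => (cone_r z ^+ 2)%:E).
Proof.
move=> la2; apply/integrableP; split.
  by apply/measurable_EFinP/measurable_funX; exact: measurable_cone_r.
by under eq_integral do rewrite gee0_abs ?lee_fin ?sqr_ge0//.
Qed.

Lemma integrable_cone_fun la (phi : dom ne -> R) : continuous phi ->
  second_moment_finite la -> la.-integrable setT (EFin \o cone_fun phi).
Proof.
move=> cphi la2; have [M M0 hM] := dom_continuous_bounded Omega_compact cphi.
apply: (le_integrable _ _ _ (integrableZl measurableT M (integrable_sqr_cone_r la2))) => //.
  by apply/measurable_EFinP; exact: measurable_cone_fun.
move=> z _ /=; rewrite lee_fin /cone_fun !normrM mulrC.
by rewrite ler_wpM2r// (ger0_norm M0).
Qed.

Context (la0 la1 : {finite_measure set (coneB ne) -> \bar R}).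
Context (ga : {measure set (coneB ne * coneB ne)%type -> \bar R}).
Hypothesis ga_plan : is_plan la0 la1 ga.

Lemma plan_fst A : measurable A -> la0 A = ga (fst @^-1` A).
Proof.
move=> /ga_plan[<- _]; congr (ga _).
by apply/seteqP; split=> p //= [].
Qed.

Lemma plan_snd A : measurable A -> la1 A = ga (snd @^-1` A).
Proof.
move=> /ga_plan[_ <-]; congr (ga _).
by apply/seteqP; split=> p //= [].
Qed.

Hypotheses (la02 : second_moment_finite la0) (la12 : second_moment_finite la1).

Lemma integrable_sqr_dcone :
  ga.-integrable setT (fun p => (dcone p.1 p.2 ^+ 2)%:E).
Proof.
have i0 := integrable_image measurable_fst plan_fst (integrable_sqr_cone_r la02).
have i1 := integrable_image measurable_snd plan_snd (integrable_sqr_cone_r la12).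
(* The squared distance is at most (r0 + r1)^2 <= 2 (r0^2 + r1^2). *)
apply: (le_integrable _ _ _ (integrableZl measurableT 2 (integrableD measurableT i0 i1))) => //.
  by apply/measurable_EFinP; exact: measurable_sqr_dcone.
move=> p _ /=; rewrite lee_fin.
rewrite (ger0_norm (sqr_ge0 _)) ger0_norm; last first.
  by apply: mulr_ge0 => //; apply: addr_ge0; exact: sqr_ge0.
rewrite sqr_dcone.
have := cos_geN1 (cone_angle p.1 p.2) => c1.
have h : - (cone_r p.1 * cone_r p.2) <=
    cone_r p.1 * cone_r p.2 * cos (cone_angle p.1 p.2).
  by rewrite -mulrN1; apply: ler_wpM2l => //; rewrite mulr_ge0 ?cone_r_ge0.
by have := sqr_ge0 (cone_r p.1 - cone_r p.2); lra.
Qed.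

(** Integrability makes the cost finite, so [fine] and [sqrte] lose nothing along the chain from
    [HKe] through [Wcone] to the plan. *)
Lemma sqr_HK_plan mu0 mu1 : optimal_lifts mu0 mu1 la0 la1 ->
  optimal_plan la0 la1 ga ->
  HK mu0 mu1 ^+ 2 = \int[ga]_p (dcone p.1 p.2 ^+ 2).
Proof.
move=> [_ _ WE] [_ cE]; rewrite /HK -WE /Wcone -cE /plan_cost.
rewrite -[X in sqrte X]fineK; last exact: integrable_fin_num integrable_sqr_dcone.
rewrite /= sqr_sqrtr//; apply: Rintegral_ge0 => p _; exact: sqr_ge0.
Qed.

End plans.

(** * Convexity passes from the cone to measures *)

Section cone_convex_imp_HK_convex.
Context (R : realType) (d : nat) (Omega : set 'rV[R]_d) (ne : Omega !=set0).
Hypothesis Omega_convex : convex_set Omega.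
Hypothesis Omega_compact : compact Omega.
Context (Phi : dom ne -> R) (Lambda : R).
Hypothesis Phi_cont : continuous Phi.

Lemma potential_energy_plan_convex
    (mu : R -> {finite_measure set (domB ne) -> \bar R}) :
  geodesically_convex (@dcone R d Omega ne) (cone_fun Phi) Lambda ->
  plan_curve mu ->
  convex_along (@HK R d Omega ne) (potential_energy Phi) Lambda mu.
Proof.
move=> PhiL [la0 [la1 [ga [opl opg mus]]]] s s01.
have [[la02 mu0E] [la12 mu1E] _] := opl; have [gapl _] := opg.
have [la [laE [la2 musE]]] := mus s s01.
(* All terms of the inequality become integrals over the one plan [ga], and a pointwise comparison
   suffices. *)
rewrite (sqr_HK_plan Omega_compact gapl la02 la12 opl opg) /potential_energy.
rewrite musE// mu0E// mu1E//.
have i0 := integrable_cone_fun Omega_compact Phi_cont la02.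
have i1 := integrable_cone_fun Omega_compact Phi_cont la12.
have is_ := integrable_cone_fun Omega_compact Phi_cont la2.
have mg := measurable_cone_geod (ne := ne) Omega_compact Omega_convex s01.
rewrite /Rintegral (integral_image (measurable_fst) (plan_fst gapl) i0).
rewrite (integral_image (measurable_snd) (plan_snd gapl) i1).
rewrite (integral_image mg laE is_).
have j0 := integrable_image measurable_fst (plan_fst gapl) i0.
have j1 := integrable_image measurable_snd (plan_snd gapl) i1.
have js := integrable_image mg laE is_.
have jd := integrable_sqr_dcone Omega_compact gapl la02 la12.
rewrite -!/(Rintegral _ _ _) -!RintegralZl//.
have k0 := integrableZl measurableT (1 - s) j0.
have k1 := integrableZl measurableT s j1.
have kd := integrableZl measurableT (Lambda * (s * (1 - s) / 2)) jd.
rewrite -RintegralD// -RintegralB//; last exact: (integrableD _ k0 k1).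
apply: le_Rintegral => //.
  exact: (integrableB _ (integrableD _ k0 k1) kd).
move=> p _; have [yg y0 y1] := cone_geodP Omega_convex p.1 p.2.
by have := PhiL _ yg s s01; rewrite y0 y1.
Qed.

End cone_convex_imp_HK_convex.

(** * Lifts of point masses and a lower bound for the cost *)

Section point_mass.
Context (R : realType) (d : nat) (Omega : set 'rV[R]_d) (ne : Omega !=set0).

(* In the paper's notation, the projection P of the Dirac mass at z. *)
Definition point_mass (z : cone ne) : set (domB ne) -> \bar R :=
  mscale (NngNum (sqr_ge0 (cone_r z))) (dirac (cone_x z : domB ne)).

HB.instance Definition _ z := Measure.on (point_mass z).

Let point_mass_fin z : fin_num_fun (point_mass z).
Proof. by move=> A mA; rewrite /point_mass /mscale /= diracE. Qed.

HB.instance Definition _ z :=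
  Measure_isFinite.Build _ _ _ (point_mass z) (@point_mass_fin z).

Lemma ge0_integral_point_mass z (f : domB ne -> \bar R) :
  measurable_fun [set: domB ne] f -> (forall x, 0 <= f x)%E ->
  (\int[point_mass z]_x f x = (cone_r z ^+ 2)%:E * f (cone_x z))%E.
Proof.
move=> mf f0; rewrite ge0_integral_mscale// integral_dirac//.
by rewrite diracT mul1e.
Qed.

Lemma Rintegral_point_mass z (phi : dom ne -> R) : continuous phi ->
  \int[point_mass z]_x phi x = cone_fun phi z.
Proof.
move=> cphi; have mphi : measurable_fun [set: domB ne] (EFin \o phi).
  by apply/measurable_EFinP; exact: continuous_measurable_dom.
rewrite /Rintegral integralE !ge0_integral_point_mass//; first last.
- exact: measurable_funepos.
- exact: measurable_funeneg.
rewrite /cone_fun; have [p|p] := leP 0 (phi (cone_x z)).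
  rewrite funeposE funenegE /= -!EFin_max /=.
  by rewrite max_l// max_r ?oppr_le0// mulr0 subr0.
rewrite funeposE funenegE /= -!EFin_max /=.
by rewrite max_r ?(ltW p)// max_l ?oppr_ge0 ?(ltW p)// mulr0 sub0r mulrN opprK.
Qed.

Lemma Rintegral_dirac_cone z (f : cone ne -> R) :
  measurable_fun [set: coneB ne] f ->
  \int[\d_(z : coneB ne)]_w f w = f z.
Proof.
move=> mf; rewrite /Rintegral integral_dirac//; last exact/measurable_EFinP.
by rewrite diracT mul1e.
Qed.

Hypothesis Omega_compact : compact Omega.

Lemma is_lift_dirac z : is_lift (\d_(z : coneB ne)) (point_mass z).
Proof.
split.
  rewrite /second_moment_finite integral_dirac//; last first.
    by apply/measurable_EFinP/measurable_funX; exact: measurable_cone_r.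
  by rewrite diracT mul1e ltry.
move=> phi cphi; rewrite Rintegral_point_mass//.
by rewrite (Rintegral_dirac_cone _ (measurable_cone_fun Omega_compact cphi)).
Qed.

Lemma is_plan_dirac z0 z1 : is_plan (\d_(z0 : coneB ne)) (\d_(z1 : coneB ne))
  (\d_((z0, z1) : coneB ne * coneB ne)%type).
Proof.
move=> A _; split; rewrite /= !diracE; congr (_%:R%:E); congr nat_of_bool.
  by apply/idP/idP; rewrite !inE /=; [case|split].
by apply/idP/idP; rewrite !inE /=; [case|split].
Qed.

Lemma plan_cost_dirac z0 z1 :
  plan_cost (\d_((z0, z1) : coneB ne * coneB ne)%type) = (dcone z0 z1 ^+ 2)%:E.
Proof.
rewrite /plan_cost integral_dirac//; last first.
  by apply/measurable_EFinP; exact: measurable_sqr_dcone.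
by rewrite diracT mul1e.
Qed.

(* A lift of the point mass is carried by the zeros of cone_fun phi, hence by the
   ray through z. *)
Lemma lift_point_mass_null z (la : {finite_measure set (coneB ne) -> \bar R}) :
  is_lift la (point_mass z) -> exists phi : dom ne -> R,
  [/\ continuous phi, forall x, 0 <= phi x, \int[la]_w cone_fun phi w = 0 &
    forall w, cone_fun phi w = 0 ->
      cone_r w = 0 \/ cone_r z != 0 /\ cone_x w = cone_x z].
Proof.
move=> [_ laE]; have [z0|z0] := eqVneq (cone_r z) 0.
  (* For z the tip the point mass is zero, so any lift has radius 0 almost everywhere; the constant
     1 detects this. *)
  exists (fun=> 1); split => //; first exact: cst_continuous.
    rewrite -[LHS]laE; last exact: cst_continuous.
    rewrite Rintegral_point_mass; last exact: cst_continuous.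
    by rewrite /cone_fun z0 expr0n mul0r.
  by move=> w /eqP; rewrite /cone_fun mulr1 sqrf_eq0 => /eqP; left.
pose phi (x : dom ne) := enorm (\val x - \val (cone_x z)).
have cphi : continuous phi by exact: continuous_dom_enorm.
exists phi; split=> //; first by move=> x; exact: enorm_ge0.
  rewrite -[LHS]laE// Rintegral_point_mass// /cone_fun /phi subrr enorm0.
  by rewrite mulr0.
move=> w /eqP; rewrite mulf_eq0 sqrf_eq0 => /orP[/eqP|/eqP/enorm0_eq0/eqP]; first by left.
by rewrite subr_eq0 => /eqP/val_inj; right.
Qed.

Lemma ae_eq0_image d' (X : measurableType d') (m : {measure set X -> \bar R})
    (la : {finite_measure set (coneB ne) -> \bar R}) (f : X -> coneB ne)
    (phi : dom ne -> R) :
  measurable_fun [set: X] f -> (forall A, measurable A -> la A = m (f @^-1` A)) ->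
  second_moment_finite la -> continuous phi -> (forall x, 0 <= phi x) ->
  \int[la]_w cone_fun phi w = 0 -> {ae m, forall x, cone_fun phi (f x) = 0}.
Proof.
move=> mf laE la2 cphi phi0 int0.
have i0 := integrable_cone_fun Omega_compact cphi la2.
have h : (\int[la]_w (cone_fun phi w)%:E = 0)%E.
  by rewrite -[LHS]fineK ?(integrable_fin_num measurableT i0)//; congr EFin.
rewrite (integral_image mf laE i0) in h.
have mcf : measurable_fun setT (fun x => (cone_fun phi (f x))%:E).
  by have := measurable_int _ (integrable_image mf laE i0).
have /(ae_eq_integral_abs m measurableT mcf) : (\int[m]_x `|(cone_fun phi (f x))%:E|)%E = 0%E.
  rewrite -[RHS]h; apply: eq_integral => x _; rewrite gee0_abs// lee_fin.
  by rewrite mulr_ge0 ?sqr_ge0.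
by apply: filterS => x /(_ I) [].
Qed.

Lemma Rintegral_lift_sqr_r z (la : {finite_measure set (coneB ne) -> \bar R}) :
  is_lift la (point_mass z) -> \int[la]_w (cone_r w ^+ 2) = cone_r z ^+ 2.
Proof.
move=> [_ laE]; have c1 : continuous (fun _ : dom ne => 1 : R).
  exact: cst_continuous.
have := laE _ c1; rewrite Rintegral_point_mass// /cone_fun mulr1 => ->.
by apply: eq_Rintegral => w _; rewrite mulr1.
Qed.

(* With k0 = c r1 / r0 and k1 = c r0 / r1, where c is the cosine of the angle,
   AM-GM gives d^2 >= (1 - k0) r^2 + (1 - k1) r'^2 on the rays carrying the
   lifts, with equality at (z0, z1). *)
Lemma plan_cost_ge z0 z1 (la0 la1 : {finite_measure set (coneB ne) -> \bar R})
    (ga : {measure set (coneB ne * coneB ne)%type -> \bar R}) :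
  0 <= cone_r z0 * cone_r z1 * cos (cone_angle z0 z1) ->
  is_lift la0 (point_mass z0) -> is_lift la1 (point_mass z1) ->
  is_plan la0 la1 ga -> ((dcone z0 z1 ^+ 2)%:E <= plan_cost ga)%E.
Proof.
set a := cone_r z0; set b := cone_r z1; set c := cos _ => abc0 li0 li1 gapl.
have [la02 _] := li0; have [la12 _] := li1.
have a0 : 0 <= a := cone_r_ge0 z0; have b0 : 0 <= b := cone_r_ge0 z1.
pose k0 := c * b / a; pose k1 := c * a / b.
have k_ge0 : 0 <= k0 /\ 0 <= k1.
  (* If a radius is 0, both constants are 0 because the inverse of 0 is 0. Otherwise the hypothesis
     yields c >= 0. *)
  have [aE|an] := eqVneq a 0; first by rewrite /k0 /k1 aE invr0 !mulr0 mul0r.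
  have [bE|bn] := eqVneq b 0; first by rewrite /k0 /k1 bE invr0 !mulr0 mul0r.
  have ab : 0 < a * b by rewrite mulr_gt0// lt_neqAle eq_sym ?an ?bn.
  have c0 : 0 <= c by rewrite -(pmulr_rge0 _ ab).
  by rewrite !divr_ge0 ?mulr_ge0.
have kE : k0 * a ^+ 2 + k1 * b ^+ 2 = 2 * a * b * c.
  rewrite /k0 /k1; have [->|an] := eqVneq a 0.
    by rewrite expr0n /= !(mulr0, mul0r) addr0.
  have [->|bn] := eqVneq b 0; first by rewrite expr0n /= !(mulr0, mul0r) addr0.
  by field; rewrite an bn.
have i0 := integrable_image measurable_fst (plan_fst gapl) (integrable_sqr_cone_r la02).
have i1 := integrable_image measurable_snd (plan_snd gapl) (integrable_sqr_cone_r la12).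
have id_ := integrable_sqr_dcone Omega_compact gapl la02 la12.
have e0 : \int[ga]_p (cone_r p.1 ^+ 2) = a ^+ 2.
  rewrite -(Rintegral_lift_sqr_r li0) /Rintegral.
  by rewrite (integral_image measurable_fst (plan_fst gapl) (integrable_sqr_cone_r la02)).
have e1 : \int[ga]_p (cone_r p.2 ^+ 2) = b ^+ 2.
  rewrite -(Rintegral_lift_sqr_r li1) /Rintegral.
  by rewrite (integral_image measurable_snd (plan_snd gapl) (integrable_sqr_cone_r la12)).
have j0 := integrableZl measurableT k0 i0.
have j1 := integrableZl measurableT k1 i1.
have il := integrableD measurableT i0 i1.
have ir := integrableD measurableT id_ (integrableD measurableT j0 j1).
pose fl (p : coneB ne * coneB ne) := cone_r p.1 ^+ 2 + cone_r p.2 ^+ 2.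
pose fr (p : coneB ne * coneB ne) :=
  dcone p.1 p.2 ^+ 2 + (k0 * cone_r p.1 ^+ 2 + k1 * cone_r p.2 ^+ 2).
(* The weighted terms sit on the right so that both integrands are nonnegative; the comparison is
   then needed only almost everywhere, where each point is on its ray or at the tip. *)
have le_lr : (\int[ga]_p (fl p)%:E <= \int[ga]_p (fr p)%:E)%E.
  apply: ae_ge0_le_integral => //.
  - by move=> p _; rewrite lee_fin addr_ge0 ?sqr_ge0.
  - exact: measurable_int il.
  - move=> p _; rewrite lee_fin; have [? ?] := k_ge0.
    by apply: addr_ge0; [|apply: addr_ge0; apply: mulr_ge0]; rewrite ?sqr_ge0.
  - exact: measurable_int ir.
  have [phi0 [cphi0 phi0_ge0 int0 null0]] := lift_point_mass_null li0.
  have [phi1 [cphi1 phi1_ge0 int1 null1]] := lift_point_mass_null li1.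
  have ae0 := ae_eq0_image measurable_fst (plan_fst gapl) la02 cphi0 phi0_ge0 int0.
  have ae1 := ae_eq0_image measurable_snd (plan_snd gapl) la12 cphi1 phi1_ge0 int1.
  apply: filterS2 ae0 ae1 => p /null0 p0 /null1 p1 _; rewrite lee_fin /fl /fr.
  rewrite sqr_dcone; have [k0_ge0 k1_ge0] := k_ge0.
  have q0 : 0 <= k0 * cone_r p.1 ^+ 2 by rewrite mulr_ge0 ?sqr_ge0.
  have q1 : 0 <= k1 * cone_r p.2 ^+ 2 by rewrite mulr_ge0 ?sqr_ge0.
  case: p0 => [p10|[an x0E]]; first by rewrite p10; lra.
  case: p1 => [p20|[bn x1E]]; first by rewrite p20; lra.
  rewrite {1}/cone_angle x0E x1E -/(cone_angle z0 z1) -/c.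
  have : 0 <= c * (a * b)^-1 * (b * cone_r p.1 - a * cone_r p.2) ^+ 2.
    rewrite mulr_ge0 ?sqr_ge0//.
    have ab : 0 < a * b by rewrite mulr_gt0// lt_neqAle eq_sym ?an ?bn.
    by rewrite divr_ge0 ?(ltW ab)// -(pmulr_rge0 _ ab).
  have -> : c * (a * b)^-1 * (b * cone_r p.1 - a * cone_r p.2) ^+ 2 =
    k0 * cone_r p.1 ^+ 2 + k1 * cone_r p.2 ^+ 2 - 2 * cone_r p.1 * cone_r p.2 * c.
    by rewrite /k0 /k1; field; rewrite an bn.
  lra.
have : \int[ga]_p fl p <= \int[ga]_p fr p.
  by rewrite /Rintegral fine_le//; exact: integrable_fin_num.
rewrite /fl /fr RintegralD// RintegralD//; last exact: (integrableD measurableT j0 j1).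
rewrite RintegralD// !RintegralZl// e0 e1 kE.
have -> : plan_cost ga = (\int[ga]_p (dcone p.1 p.2 ^+ 2))%:E.
  by rewrite /Rintegral fineK//; exact: integrable_fin_num id_.
by rewrite lee_fin sqr_dcone -/a -/b -/c; lra.
Qed.

End point_mass.

(** * Convexity passes from measures to the cone *)

Section HK_convex_imp_cone_convex.
Context (R : realType) (d : nat) (Omega : set 'rV[R]_d) (ne : Omega !=set0).
Hypothesis Omega_convex : convex_set Omega.
Hypothesis Omega_compact : compact Omega.
Implicit Types (z w : cone ne) (y : R -> cone ne) (s u p q : R).

(** The scalar product of the associated planar vectors; it vanishes when either point is the
    tip. *)
Definition cone_dot z w : R := cone_r z * cone_r w * cos (cone_angle z w).

Lemma cone_dotE z w :
  2 * cone_dot z w = cone_r z ^+ 2 + cone_r w ^+ 2 - dcone z w ^+ 2.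
Proof. by rewrite sqr_dcone /cone_dot; ring. Qed.

Lemma Wcone_dirac z0 z1 : 0 <= cone_dot z0 z1 ->
  ereal_inf [set plan_cost ga | ga in is_plan (\d_(z0 : coneB ne)) (\d_(z1 : coneB ne))]
  = (dcone z0 z1 ^+ 2)%:E.
Proof.
move=> z01; apply/eqP; rewrite eq_le; apply/andP; split.
  apply: ereal_inf_lbound; exists (\d_((z0, z1) : coneB ne * coneB ne)%type).
    exact: is_plan_dirac.
  exact: plan_cost_dirac.
apply: le_ereal_inf_tmp => _ [ga gapl <-].
by apply: (plan_cost_ge Omega_compact z01 _ _ gapl); exact: is_lift_dirac.
Qed.

(** The bound [plan_cost_ge] covers all pairs of lifts and all their plans, so it settles both
    minimizations at once. *)
Lemma optimal_lifts_dirac z0 z1 : 0 <= cone_dot z0 z1 ->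
  HKe (point_mass z0) (point_mass z1) = (dcone z0 z1)%:E /\
  optimal_lifts (point_mass z0) (point_mass z1)
    (\d_(z0 : coneB ne)) (\d_(z1 : coneB ne)).
Proof.
move=> z01.
have WE : Wcone (\d_(z0 : coneB ne)) (\d_(z1 : coneB ne)) = (dcone z0 z1)%:E.
  by rewrite /Wcone Wcone_dirac//= sqrtr_sqr ger0_norm// dcone_ge0.
have HE : HKe (point_mass z0) (point_mass z1) = (dcone z0 z1)%:E.
  apply/eqP; rewrite eq_le; apply/andP; split.
    apply: ereal_inf_lbound; exists (\d_(z0 : coneB ne)), (\d_(z1 : coneB ne)).
    by split; rewrite ?WE//; exact: is_lift_dirac.
  apply: le_ereal_inf_tmp => _ [la0 [la1 [li0 li1 ->]]].
  rewrite -[leLHS](_ : sqrte (dcone z0 z1 ^+ 2)%:E = _); last first.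
    by rewrite /= sqrtr_sqr ger0_norm// dcone_ge0.
  have lb : ((dcone z0 z1 ^+ 2)%:E <=
      ereal_inf [set plan_cost ga | ga in is_plan la0 la1])%E.
    apply: le_ereal_inf_tmp => _ [ga gapl <-].
    exact: (plan_cost_ge Omega_compact z01 li0 li1 gapl).
  by rewrite lee_sqrt// (le_trans _ lb)// lee_fin sqr_ge0.
split=> //; split; rewrite ?WE ?HE//; exact: is_lift_dirac.
Qed.

Lemma HK_point_mass z0 z1 : 0 <= cone_dot z0 z1 ->
  HK (point_mass z0) (point_mass z1) = dcone z0 z1.
Proof. by move=> /optimal_lifts_dirac[HE _]; rewrite /HK HE. Qed.

(** The bilinear expansion along the planar segment, obtained by polarization from distances and
    radii without any base points. *)
Lemma geodesic_dot y s u : is_geodesic (@dcone R d Omega ne) y ->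
  0 <= s <= 1 -> 0 <= u <= 1 ->
  cone_dot (y s) (y u) =
  (1 - s) * (1 - u) * cone_r (y 0) ^+ 2 + s * u * cone_r (y 1) ^+ 2 +
    ((1 - s) * u + s * (1 - u)) * cone_dot (y 0) (y 1).
Proof.
move=> yg s01 u01; apply: (@mulfI _ 2) => //.
rewrite cone_dotE (sqr_between_r s01 (geodesic_between yg s01)).
rewrite (sqr_between_r u01 (geodesic_between yg u01)) (yg s u s01 u01).
rewrite exprMn real_normK ?num_real//.
have := cone_dotE (y 0) (y 1); move: (dcone (y 0) (y 1) ^+ 2) => D.
move=> dotE; have -> : D = cone_r (y 0) ^+ 2 + cone_r (y 1) ^+ 2
  - 2 * cone_dot (y 0) (y 1) by lra.
ring.
Qed.

Lemma geodesic_sub y p q : is_geodesic (@dcone R d Omega ne) y ->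
  0 <= p -> p <= q -> q <= 1 ->
  is_geodesic (@dcone R d Omega ne) (fun s => y (p + (q - p) * s)).
Proof.
move=> yg p0 pq q1.
have itv s : 0 <= s <= 1 -> 0 <= p + (q - p) * s <= 1.
  move=> /andP[s0 s1]; have h : 0 <= (q - p) * s by rewrite mulr_ge0// subr_ge0.
  have : (q - p) * s <= (q - p) * 1 by rewrite ler_wpM2l// subr_ge0.
  by move=> ?; apply/andP; split; lra.
have i0 : 0 <= (0 : R) <= 1 by rewrite lexx ler01.
have i1 : 0 <= (1 : R) <= 1 by rewrite lexx ler01.
move=> s u s01 u01; rewrite (yg _ _ (itv s s01) (itv u u01)).
rewrite (yg _ _ (itv 0 i0) (itv 1 i1)) mulrA -normrM -[in RHS]normrN.
by congr (`|_| * _); ring.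
Qed.

Context (Phi : dom ne -> R) (Lambda : R).
Hypothesis Phi_cont : continuous Phi.
Hypothesis HK_convex : forall mu : R -> {finite_measure set (domB ne) -> \bar R},
  is_geodesic (@HK R d Omega ne) mu -> plan_curve mu ->
  convex_along (@HK R d Omega ne) (potential_energy Phi) Lambda mu.

(* A geodesic whose end points span an angle at most pi/2 projects to a
   Hellinger-Kantorovich geodesic of point masses. *)
Lemma convex_along_acute y : is_geodesic (@dcone R d Omega ne) y ->
  0 <= cone_dot (y 0) (y 1) -> convex_along (@dcone R d Omega ne) (cone_fun Phi) Lambda y.
Proof.
move=> yg y01.
(* Acuteness of the ends passes to every pair of points, as needed for the whole projected curve to
   be a geodesic. *)
have ydot s u : 0 <= s <= 1 -> 0 <= u <= 1 -> 0 <= cone_dot (y s) (y u).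
  move=> s01 u01; rewrite geodesic_dot//; move: s01 u01 => /andP[s0 s1] /andP[u0 u1].
  have [s1' u1'] : 0 <= 1 - s /\ 0 <= 1 - u by rewrite !subr_ge0.
  apply: addr_ge0; last by apply: mulr_ge0 => //; apply: addr_ge0; exact: mulr_ge0.
  by apply: addr_ge0; apply: mulr_ge0; rewrite ?exprn_ge0 ?cone_r_ge0//; exact: mulr_ge0.
have i0 : 0 <= (0 : R) <= 1 by rewrite lexx ler01.
have i1 : 0 <= (1 : R) <= 1 by rewrite lexx ler01.
pose mu s : {finite_measure set (domB ne) -> \bar R} := point_mass (y s).
have HKE s u : 0 <= s <= 1 -> 0 <= u <= 1 -> HK (mu s) (mu u) = dcone (y s) (y u).
  by move=> s01 u01; apply: HK_point_mass; exact: ydot.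
have mug : is_geodesic (@HK R d Omega ne) mu.
  by move=> s u s01 u01; rewrite !HKE//; exact: yg.
have muc : plan_curve mu.
  exists (\d_(y 0 : coneB ne)), (\d_(y 1 : coneB ne)),
    (\d_((y 0, y 1) : coneB ne * coneB ne)%type); split.
  - by have [] := optimal_lifts_dirac y01.
  - split; first exact: is_plan_dirac.
    by rewrite Wcone_dirac// plan_cost_dirac.
  - move=> s s01; exists (\d_(y s : coneB ne)); split; last exact: is_lift_dirac.
    move=> A _; rewrite /pushforward /= !diracE; congr (_%:R%:E); congr nat_of_bool.
    by apply/idP/idP; rewrite !inE /= cone_geodE// -geodesic_eq.
move=> s s01; have := HK_convex mug muc s01.
by rewrite HKE// /potential_energy /mu !Rintegral_point_mass.
Qed.

(* Along cone geodesics r^2 is exactly 2-convex, so subtracting Lambda / 2 from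
   the potential reduces to Lambda = 0. *)
Local Notation h := (cone_fun (fun x => Phi x - Lambda / 2)).

Lemma cone_fun_shift z : h z = cone_fun Phi z - Lambda / 2 * cone_r z ^+ 2.
Proof. by rewrite /cone_fun; ring. Qed.

Lemma convex_along_shift y : is_geodesic (@dcone R d Omega ne) y ->
  convex_along (@dcone R d Omega ne) (cone_fun Phi) Lambda y <->
  forall s, 0 <= s <= 1 -> h (y s) <= (1 - s) * h (y 0) + s * h (y 1).
Proof.
move=> yg.
suff shiftE s : 0 <= s <= 1 -> (1 - s) * h (y 0) + s * h (y 1) - h (y s) =
    (1 - s) * cone_fun Phi (y 0) + s * cone_fun Phi (y 1)
    - Lambda * (s * (1 - s) / 2) * dcone (y 0) (y 1) ^+ 2 - cone_fun Phi (y s).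
  by split=> yL s s01; have := yL s s01; rewrite -subr_ge0 => ?;
    rewrite -subr_ge0 ?shiftE// -shiftE.
move=> s01; rewrite !cone_fun_shift.
by rewrite (sqr_between_r s01 (geodesic_between yg s01)); field.
Qed.

(** The chord inequality on [p, q] with denominators cleared, ready for linear arithmetic when
    pieces are glued. *)
Lemma acute_chord y p q s : is_geodesic (@dcone R d Omega ne) y ->
  0 <= p -> p < q -> q <= 1 -> p <= s <= q -> 0 <= cone_dot (y p) (y q) ->
  (q - p) * h (y s) <= (q - s) * h (y p) + (s - p) * h (y q).
Proof.
move=> yg p0 pq q1 /andP[ps sq] ypq.
have qp0 : 0 < q - p by rewrite subr_gt0.
have wg := geodesic_sub yg p0 (ltW pq) q1.
have k01 : 0 <= (s - p) / (q - p) <= 1.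
  rewrite divr_ge0 ?subr_ge0 ?(ltW pq)//= ler_pdivrMr// mul1r; lra.
have pqE : p + (q - p) = q by ring.
have := convex_along_acute wg; rewrite mulr0 mulr1 addr0 pqE => /(_ ypq).
move=> /(convex_along_shift wg)/(_ _ k01); rewrite mulr0 mulr1 addr0 pqE.
have -> : p + (q - p) * ((s - p) / (q - p)) = s.
  by rewrite mulrCA mulfV ?gt_eqF// mulr1; ring.
rewrite -(ler_pM2l qp0) => /le_trans; apply; rewrite le_eqVlt; apply/orP; left.
by apply/eqP; field; rewrite gt_eqF.
Qed.

(** At the midpoint between the tip and z the 2-homogeneous function takes a quarter of its value at
    z, while the chord allows a half. *)
Lemma cone_fun_shift_ge0 z : 0 <= h z.
Proof.
have [r0|r0] := eqVneq (cone_r z) 0; first by rewrite /cone_fun r0 expr0n mul0r.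
have rgt0 : 0 < cone_r z by rewrite lt_neqAle eq_sym r0 cone_r_ge0.
pose tip : cone ne := cone_pt point (NngNum (lexx (0 : R))).
have tip0 : cone_r tip = 0 := (cone_ptP _ _).1.
have r2 : 0 <= cone_r z / 2 by rewrite divr_ge0// cone_r_ge0.
pose w : cone ne := cone_pt (cone_x z) (NngNum r2).
have wr : cone_r w = cone_r z / 2 := (cone_ptP _ _).1.
have wx : cone_x w = cone_x z.
  by apply: (cone_ptP _ _).2; rewrite /= gt_eqF// divr_gt0.
have half01 : 0 <= (2^-1 : R) <= 1 by rewrite invr_ge0 ler0n invf_le1 ?ler1n.
have dtip v : dcone tip v = cone_r v.
  apply/eqP; rewrite -(@eqrXn2 _ 2) ?dcone_ge0 ?cone_r_ge0// sqr_dcone tip0.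
  by rewrite expr0n mulr0 !mul0r subr0 add0r.
have dwz : dcone w z = cone_r z / 2.
  apply/eqP; rewrite -(@eqrXn2 _ 2) ?dcone_ge0// sqr_dcone wr /cone_angle wx.
  by rewrite subrr enorm0 min_l ?pi_ge0// cos0; apply/eqP; field.
have [yg y0 y1] := cone_geodP Omega_convex tip z.
have yw : cone_geod tip z 2^-1 = w.
  apply: (between_unique half01 (z0 := tip) (z1 := z)).
    by have := geodesic_between yg half01; rewrite y0 y1.
  by split; [rewrite !dtip wr mulrC|rewrite dtip dwz; field].
have := @acute_chord _ 0 1 2^-1 yg (lexx _) ltr01 (lexx _) half01.
rewrite y0 y1 yw /cone_dot tip0 !mul0r => /(_ (lexx _)).
rewrite /cone_fun wx wr tip0 expr0n mul0r mulr0 add0r.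
have r4 : 0 < cone_r z ^+ 2 by rewrite exprn_gt0.
lra.
Qed.

(* Two overlapping acute pieces, or two pieces meeting at the tip, where h = 0. *)
Lemma chord_glue y p q : is_geodesic (@dcone R d Omega ne) y ->
  0 < p -> p <= q -> q < 1 ->
  0 <= cone_dot (y 0) (y q) -> 0 <= cone_dot (y p) (y 1) ->
  p < q \/ h (y p) = 0 /\ h (y q) = 0 ->
  forall s, 0 <= s <= 1 -> h (y s) <= (1 - s) * h (y 0) + s * h (y 1).
Proof.
move=> yg p0 pq q1 y0q yp1 cases.
(* [H] is the excess over the chord. Subtracting an affine function preserves chord inequalities,
   and [H] vanishes at 0 and 1. *)
pose H s := h (y s) - ((1 - s) * h (y 0) + s * h (y 1)).
have q0 : 0 < q := lt_le_trans p0 pq.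
have p1 : p < 1 := le_lt_trans pq q1.
have left_ s : 0 <= s <= q -> q * H s <= s * H q.
  by move=> s0q; have := acute_chord yg (lexx 0) q0 (ltW q1) s0q y0q; rewrite /H; lra.
have right_ s : p <= s <= 1 -> (1 - p) * H s <= (1 - s) * H p.
  by move=> sp1; have := acute_chord yg (ltW p0) p1 (lexx 1) sp1 yp1; rewrite /H; lra.
have [Hp Hq] : H p <= 0 /\ H q <= 0.
  case: cases => [pq'|[hp hq]]; last first.
    have h0 := cone_fun_shift_ge0 (y 0); have h1 := cone_fun_shift_ge0 (y 1).
    rewrite /H hp hq !sub0r !oppr_le0.
    by split; apply: addr_ge0; apply: mulr_ge0 => //; lra.
  (* Each cut point is bounded through the other; eliminating [H q] leaves (q - p) H p <= 0, which
     is where p < q is used. *)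
  have l := left_ p; have r := right_ q.
  have {}l : q * H p <= p * H q by apply: l; rewrite (ltW p0).
  have {}r : (1 - p) * H q <= (1 - q) * H p by apply: r; rewrite pq (ltW q1).
  have Hp : H p <= 0.
    have : (1 - p) * (q * H p) <= (1 - p) * (p * H q) by rewrite ler_pM2l ?subr_gt0.
    have : p * ((1 - p) * H q) <= p * ((1 - q) * H p) by rewrite ler_pM2l.
    move=> h1 h2; have : (q - p) * H p <= 0 by lra.
    by rewrite pmulr_rle0// subr_gt0.
  split=> //; rewrite -(pmulr_rle0 _ (_ : 0 < 1 - p)) ?subr_gt0//.
  by apply: le_trans r _; rewrite mulr_ge0_le0// subr_ge0 ltW.
move=> s /andP[s0 s1]; rewrite -subr_le0 -/(H s).
have [sq|qs] := leP s q.
  rewrite -(pmulr_rle0 _ q0); apply: le_trans (left_ s _) _; first by rewrite s0.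
  exact: mulr_ge0_le0.
rewrite -(pmulr_rle0 _ (_ : 0 < 1 - p)) ?subr_gt0//.
apply: le_trans (right_ s _) _; first by rewrite s1 (le_trans pq (ltW qs)).
by rewrite mulr_ge0_le0// subr_ge0.
Qed.

Lemma cone_fun_geodesically_convex :
  geodesically_convex (@dcone R d Omega ne) (cone_fun Phi) Lambda.
Proof.
move=> y yg; have [y01|y01] := leP 0 (cone_dot (y 0) (y 1)).
  exact: convex_along_acute.
apply/(convex_along_shift yg) => s s01.
have i0 : 0 <= (0 : R) <= 1 by rewrite lexx ler01.
have i1 : 0 <= (1 : R) <= 1 by rewrite lexx ler01.
pose a := cone_r (y 0); pose b := cone_r (y 1).
pose k := - cos (cone_angle (y 0) (y 1)).
have dotE : cone_dot (y 0) (y 1) = - (a * b * k) by rewrite /cone_dot /k mulrN opprK.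
have [a0 b0] : 0 < a /\ 0 < b.
  rewrite !lt_neqAle !cone_r_ge0 !andbT !(eq_sym 0); split; apply/eqP => r0;
  by move: y01; rewrite dotE r0 ?mulr0 !mul0r oppr0 ltxx.
have k0 : 0 < k.
  by move: y01; rewrite dotE oppr_lt0 pmulr_rgt0// mulr_gt0.
have k1 : k <= 1 by rewrite /k lerNl cos_geN1.
(* These solve [cone_dot (y p) (y 1) = 0] and [cone_dot (y 0) (y q) = 0]. The sign of 1 - k^2 gives
   p <= q. *)
pose p := k * a / (b + k * a); pose q := a / (a + k * b).
have ka : 0 < k * a by rewrite mulr_gt0.
have kb : 0 < k * b by rewrite mulr_gt0.
have dp : 0 < b + k * a by rewrite addr_gt0.
have dq : 0 < a + k * b by rewrite addr_gt0.
have p0 : 0 < p by rewrite divr_gt0.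
have q1 : q < 1 by rewrite ltr_pdivrMr// mul1r ltrDl.
have qp : q - p = a * b * (1 - k ^+ 2) / ((a + k * b) * (b + k * a)).
  by rewrite /p /q; field; rewrite !gt_eqF.
have k2 : 0 <= 1 - k ^+ 2 by rewrite subr_ge0 expr_le1// ltW.
have pq : p <= q.
  by rewrite -subr_ge0 qp divr_ge0 ?mulr_ge0// ltW.
have q01 : 0 <= q <= 1 by rewrite (ltW q1) (le_trans (ltW p0) pq).
have p01 : 0 <= p <= 1 by rewrite (ltW p0) (le_trans pq (ltW q1)).
apply: (chord_glue yg p0 pq q1) => //.
- rewrite geodesic_dot// dotE -/a -/b /q le_eqVlt; apply/orP; left; apply/eqP.
  by field; rewrite gt_eqF.
- rewrite geodesic_dot// dotE -/a -/b /p le_eqVlt; apply/orP; left; apply/eqP.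
  by field; rewrite gt_eqF.
have [pq'|] := ltP p q; [by left|move=> qp'; right].
have pqE : p = q by apply/eqP; rewrite eq_le pq qp'.
(* The cuts coincide only at angle pi, and the common point has zero scalar product with itself, so
   it is the tip. *)
have kE : k = 1.
  have /eqP : q - p = 0 by rewrite pqE subrr.
  rewrite qp mulf_eq0 invr_eq0 (gt_eqF (mulr_gt0 dq dp)) orbF.
  rewrite mulf_eq0 (gt_eqF (mulr_gt0 a0 b0)) /= subr_eq0 => /eqP k2E.
  by apply/eqP; rewrite -(@eqrXn2 _ 2)// ?(ltW k0)// expr1n -k2E.
have rq : cone_r (y q) = 0.
  have qq : cone_dot (y q) (y q) = 0.
    have ab0 : a + b != 0 by rewrite gt_eqF ?addr_gt0.
    by rewrite geodesic_dot// dotE -/a -/b kE /q kE; field.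
  have := cone_dotE (y q) (y q); rewrite (yg q q q01 q01) subrr normr0 mul0r qq.
  rewrite mulr0 expr0n subr0 => e; apply/eqP; rewrite -sqrf_eq0; apply/eqP.
  by move: e; rewrite /=; lra.
by rewrite pqE /cone_fun rq expr0n mul0r.
Qed.

End HK_convex_imp_cone_convex.

Unset Implicit Arguments.
Set Strict Implicit.
Set Printing Implicit Defensive.

Theorem proposition5p2 (R : realType) (d : nat) (Omega : set 'rV[R]_d)
  (Omega_ne : Omega !=set0) (Omega_convex : convex_set Omega)
  (Omega_compact : compact Omega)
  (Phi : dom Omega_ne -> R) (Phi_cont : continuous Phi) (Lambda : R) :
  (forall mu : R -> {finite_measure set (domB Omega_ne) -> \bar R},
     is_geodesic (@HK R d Omega Omega_ne) mu -> plan_curve mu ->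
     convex_along (@HK R d Omega Omega_ne) (potential_energy Phi) Lambda mu)
  <-> geodesically_convex (@dcone R d Omega Omega_ne) (cone_fun Phi) Lambda.
Proof.
split=> [HK_convex|cone_convex mu _ mu_plan].
  exact: (cone_fun_geodesically_convex Omega_convex Omega_compact Phi_cont HK_convex).
exact: (potential_energy_plan_convex Omega_convex Omega_compact Phi_cont cone_convex mu_plan).
Qed.
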